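(* Let $a\in\mathbb{R}\setminus\{0\}$ and let $\gamma_0(t)=(\cos t,\sin t)$ be the unit circle. For $a<0$, the circle $\gamma_0$ is a local minimum of $\mathcal{B}_a$; for $a\in(0,\tfrac13)$, it is a local maximum; for $a>\tfrac75$, it is a local minimum; and in other cases the Hessian is not sign-definite. The Hessian is degenerate (with 1-dimensional kernel) if and only if $a=\frac{k^2-2}{k^2-4}$ for some positive integer $k$.
   Context: $[\cdot,\cdot]$ denotes the determinant of two vectors in $\mathbb{R}^2$. Consider smooth $2\pi$-periodic curves $\gamma:\mathbb{R}\to\mathbb{R}^2$ in centroaffine parameterization, i.e. with $[\gamma,\gamma']=1$, and with centroaffine curvature $p=[\gamma',\gamma'']>0$ (so $\gamma''=-p\gamma$). On this space of curves, $\mathcal{B}_a(\gamma)=\int_0^{2\pi}p(t)^a\,dt$. The unit circle $\gamma_0$ is a critical curve of $\mathcal{B}_a$ for every $a$. For a second order deformation $\gamma_0+\varepsilon\gamma_1+\varepsilon^2\gamma_2$ of $\gamma_0$ in this space one has $\gamma_1=-\tfrac{f'}{2}\gamma_0+f\gamma_0'$ with $f$ a $2\pi$-periodic function, and the Hessian of $\mathcal{B}_a$ at $\gamma_0$ is the quadratic form in $f$ given by the $\varepsilon^2$-coefficient of $\mathcal{B}_a$. The functional $\mathcal{B}_a$ is invariant under the action of $SL(2,\mathbb{R})$ on curves; the corresponding infinitesimal deformations, $f\in\mathrm{span}(1,\cos 2t,\sin 2t)$, are regarded as trivial, and the statements are understood modulo them.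
   Formalization: The kernel modulo trivial deformations is span(cos kt, sin kt), of real dimension 2, so ''1-dimensional'' is stated as a complex line in the Fourier coordinates (c_n ↦ i c_n); k = 2, where the formula for a is undefined, is excluded. *)

(* Defs.v *)
From Stdlib Require Import Reals.
From Coquelicot Require Import Coquelicot.
Open Scope R_scope.

Definition det (u v : R * R) : R := fst u * snd v - snd u * fst v.

Definition smooth (f : R -> R) : Prop := forall n t, ex_derive_n f n t.

Definition periodic {T : Type} (f : R -> T) : Prop :=
  forall t, f (t + 2 * PI) = f t.

Definition curve : Type := R -> R * R.

Definition smooth_curve (g : curve) : Prop :=
  smooth (fun t => fst (g t)) /\ smooth (fun t => snd (g t)).

Definition Dcurve (n : nat) (g : curve) : curve := fun t =>
  (Derive_n (fun s => fst (g s)) n t, Derive_n (fun s => snd (g s)) n t).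

Definition centroaffine_curvature (g : curve) (t : R) : R :=
  det (Dcurve 1 g t) (Dcurve 2 g t).

Definition curve_space (g : curve) : Prop :=
  smooth_curve g /\ periodic g /\
  (forall t, det (g t) (Dcurve 1 g t) = 1) /\
  (forall t, 0 < centroaffine_curvature g t).

Definition calB (a : R) (g : curve) : R :=
  RInt (fun t => Rpower (centroaffine_curvature g t) a) 0 (2 * PI).

Definition circle : curve := fun t => (cos t, sin t).

(* The sets [Cr_close r delta g0] form a neighbourhood basis of [g0] for the
   C^infinity topology on periodic smooth curves. *)
Definition Cr_close (r : nat) (delta : R) (g0 g : curve) : Prop :=
  forall j t, (j <= r)%nat ->
    Rabs (fst (Dcurve j g t) - fst (Dcurve j g0 t)) < delta /\
    Rabs (snd (Dcurve j g t) - snd (Dcurve j g0 t)) < delta.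

Definition local_min (F : curve -> R) (g0 : curve) : Prop :=
  exists (r : nat) (delta : R), 0 < delta /\
    forall g, curve_space g -> Cr_close r delta g0 g -> F g0 <= F g.

Definition local_max (F : curve -> R) (g0 : curve) : Prop :=
  local_min (fun g => - F g) g0.

Definition admissible (f : R -> R) : Prop := smooth f /\ periodic f.

Definition add_curve (g h : curve) : curve := fun t =>
  (fst (g t) + fst (h t), snd (g t) + snd (h t)).

Definition scale_curve (c : R -> R) (g : curve) : curve := fun t =>
  (c t * fst (g t), c t * snd (g t)).

Definition gamma1 (f : R -> R) : curve :=
  add_curve (scale_curve (fun t => - (Derive f t / 2)) circle)
            (scale_curve f (Dcurve 1 circle)).

Definition deformation (g1 g2 : curve) (eps : R) : curve :=
  add_curve circle
    (add_curve (scale_curve (fun _ => eps) g1)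
               (scale_curve (fun _ => eps ^ 2) g2)).

(* The two equations are the vanishing of the coefficients of eps and eps^2 in
   [g, g'] - 1, where g = deformation g1 g2 eps. *)
Definition second_order_deformation (g1 g2 : curve) : Prop :=
  smooth_curve g1 /\ periodic g1 /\ smooth_curve g2 /\ periodic g2 /\
  (forall t, det (circle t) (Dcurve 1 g1 t) +
             det (g1 t) (Dcurve 1 circle t) = 0) /\
  (forall t, det (circle t) (Dcurve 1 g2 t) + det (g1 t) (Dcurve 1 g1 t) +
             det (g2 t) (Dcurve 1 circle t) = 0).

(* b eps = c0 + c1 eps + q eps^2 + o(eps^2) as eps tends to 0. *)
Definition is_eps2_coefficient (b : R -> R) (q : R) : Prop :=
  exists c0 c1 : R,
    is_lim (fun eps => (b eps - c0 - c1 * eps) / eps ^ 2) 0 q.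

(* Independence of the choice of g2 is part of the definition; since some g2
   exists, Q is determined on all admissible f. *)
Definition is_hessian (a : R) (Q : (R -> R) -> R) : Prop :=
  forall f, admissible f ->
    (exists g2, second_order_deformation (gamma1 f) g2) /\
    (forall g2, second_order_deformation (gamma1 f) g2 ->
       is_eps2_coefficient
         (fun eps => calB a (deformation (gamma1 f) g2 eps)) (Q f)).

Definition trivial_deformation (f : R -> R) : Prop :=
  exists c0 c1 c2 : R, forall t,
    f t = c0 + c1 * cos (2 * t) + c2 * sin (2 * t).

Definition positive_definite (Q : (R -> R) -> R) : Prop :=
  forall f, admissible f -> ~ trivial_deformation f -> 0 < Q f.

Definition negative_definite (Q : (R -> R) -> R) : Prop :=
  forall f, admissible f -> ~ trivial_deformation f -> Q f < 0.

Definition sign_definite (Q : (R -> R) -> R) : Prop :=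
  positive_definite Q \/ negative_definite Q.

(* The radical of the polar form Q (f + g) - Q f - Q g. *)
Definition in_kernel (Q : (R -> R) -> R) (f : R -> R) : Prop :=
  admissible f /\
  forall g, admissible g -> Q (fun t => f t + g t) - Q f - Q g = 0.

Definition degenerate (Q : (R -> R) -> R) : Prop :=
  exists f, in_kernel Q f /\ ~ trivial_deformation f.

Definition cos_coef (f : R -> R) (n : nat) : R :=
  RInt (fun t => f t * cos (INR n * t)) 0 (2 * PI) / PI.

Definition sin_coef (f : R -> R) (n : nat) : R :=
  RInt (fun t => f t * sin (INR n * t)) 0 (2 * PI) / PI.

(* Writing f = c_0 + Re (sum_(n >= 1) c_n e^(i n t)), with
   c_n = cos_coef f n - i sin_coef f n for n >= 1, the function g is a
   representative of i f: its coefficients are i c_n for every n >= 1.  This is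
   a complex structure on the admissible functions modulo the trivial ones. *)
Definition times_i (f g : R -> R) : Prop :=
  forall n, (1 <= n)%nat ->
    cos_coef g n = sin_coef f n /\ sin_coef g n = - cos_coef f n.

(* Modulo trivial deformations, the kernel is the complex line spanned by f0:
   its elements are the (x + i y) f0 with x, y real.  Each frequency n
   contributes one complex coordinate c_n, that is both cos (n t) and
   sin (n t); over the real numbers the dimension is 2. *)
Definition one_dimensional_kernel (Q : (R -> R) -> R) : Prop :=
  exists f0 if0 : R -> R,
    admissible f0 /\ ~ trivial_deformation f0 /\
    admissible if0 /\ times_i f0 if0 /\
    forall f, admissible f ->
      (in_kernel Q f <->
       exists x y : R,
         trivial_deformation (fun t => f t - (x * f0 t + y * if0 t))).

(* Main.v *)
Require Import Defs.
From Stdlib Require Import Reals Lra Lia Classical FunctionalExtensionality.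
From Coquelicot Require Import Coquelicot.
Open Scope R_scope.

(** The curvature [p = 1 + q] does not change under [SL(2)], so a curve near the circle may be
    moved to start like the circle; Gronwall then bounds its displacement by the [L^2] norm of
    [q].  With [N] the radial displacement, [q = - (N'' + 4 N)] and
    [int q = int (N'' + 4 N) N] up to terms of higher order.  The Fourier symbol of
    [N'' + 4 N] is [4 - n^2], and [(4 - n^2) (1 - n^2) >= 0], [(4 - n^2) (9 - n^2) >= 0] for every
    integer [n], so [int q] lies between [- 1/5 int q^2] and [1/3 int q^2], asymptotically.
    Inserting this in [int (1 + q)^a = 2 pi + a int q + a (a - 1) / 2 int q^2 + ...] gives the
    local extrema.  The Hessian is diagonal in the Fourier basis, with eigenvalue
    [a n^2 (n^2 - 4) ((a - 1) (n^2 - 4) - 2) / 8] at frequency [n]. *)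

(** A definite Hessian would not by itself give a local extremum: the space of curves is
    infinite-dimensional, and the remainder has to be beaten on every nearby curve. The extrema are
    therefore proved for the functional itself, and every error is bounded by a small multiple of
    [int q^2], not merely by a power of the distance to the circle. This forces the normalization:
    an [SL(2)] image of the circle has [q = 0] without being the circle, so [q] controls the
    displacement only once the initial data are fixed.

    What ties [int q] to [int q^2] is that the curve closes up. With [T] the tangential
    displacement, [N'' = 2 T' - q (1 + N)], and integration over a period leaves
    [int q = - int q N]. The numbers 1 and 9 are the squares next to 4, whence [1/3 = 1/(4 - 1)] and
    [1/5 = 1/(9 - 4)]. The thresholds in [a] are then the roots of
    [a/3 + a (a - 1)/2 = a (3 a - 1)/6] and [- a/5 + a (a - 1)/2 = a (5 a - 7)/10]. The same
    frequencies 1 and 3 witness indefiniteness in between. *)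

(** * Smooth and continuous functions *)

Definition cont (f : R -> R) : Prop := forall t, continuous f t.

(** Differentiating at the inner end makes closure under sums and products a plain induction, with
    no Leibniz formula for [Derive_n]. *)
Fixpoint Ck (n : nat) (f : R -> R) : Prop :=
  match n with
  | O => True
  | S m => (forall t, ex_derive f t) /\ Ck m (Derive f)
  end.

Lemma Derive_n_shift f n t : Derive_n f (S n) t = Derive_n (Derive f) n t.
Proof.
  change (Derive f) with (Derive_n f 1).
  rewrite Derive_n_comp. now replace (n + 1)%nat with (S n) by lia.
Qed.

Lemma smooth_step f :
  smooth f <-> (forall t, ex_derive f t) /\ smooth (Derive f).
Proof.
  split.
  - intros H; split.
    + intros t. exact (H 1%nat t).
    + intros [|n] t; [exact I|].
      generalize (H (S (S n)) t). simpl.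
      apply ex_derive_ext. intros u. exact (Derive_n_shift f n u).
  - intros [H1 H2] [|[|n]] t; [exact I|exact (H1 t)|].
    generalize (H2 (S n) t). simpl.
    apply ex_derive_ext. intros u. symmetry. exact (Derive_n_shift f n u).
Qed.

Lemma smooth_ex_derive f t : smooth f -> ex_derive f t.
Proof. intros H; apply smooth_step in H; apply H. Qed.

Lemma smooth_Derive f : smooth f -> smooth (Derive f).
Proof. intros H; apply smooth_step in H; apply H. Qed.

Lemma smooth_Ck f : smooth f <-> forall n, Ck n f.
Proof.
  split.
  - intros H n; revert f H; induction n as [|n IH]; intros f H; [exact I|].
    split; [intros t; now apply smooth_ex_derive|].
    now apply IH, smooth_Derive.
  - intros H n; revert f H; induction n as [|n IH]; intros f H t; [exact I|].
    destruct n as [|n]; [exact (proj1 (H 1%nat) t)|].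
    assert (HD : forall m, Ck m (Derive f)) by (intros m; exact (proj2 (H (S m)))).
    generalize (IH (Derive f) HD t). simpl.
    apply ex_derive_ext. intros u. symmetry. exact (Derive_n_shift f n u).
Qed.

Lemma Ck_le n f : Ck (S n) f -> Ck n f.
Proof.
  revert f; induction n as [|n IH]; intros f H; [exact I|].
  split; [apply H|]. apply IH, H.
Qed.

Lemma Ck_plus n f g : Ck n f -> Ck n g -> Ck n (fun t => f t + g t).
Proof.
  revert f g; induction n as [|n IH]; intros f g Hf Hg; [exact I|].
  destruct Hf as [Hf Hf'], Hg as [Hg Hg']; split.
  - intros t. now apply (ex_derive_plus (V := R_NormedModule)).
  - replace (Derive (fun t => f t + g t)) with (fun t => Derive f t + Derive g t).
    + now apply IH.
    + apply functional_extensionality; intros t; symmetry; now apply Derive_plus.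
Qed.

Lemma Ck_mult n f g : Ck n f -> Ck n g -> Ck n (fun t => f t * g t).
Proof.
  revert f g; induction n as [|n IH]; intros f g Hf Hg; [exact I|].
  split.
  - intros t. apply ex_derive_mult; [apply Hf|apply Hg].
  - replace (Derive (fun t => f t * g t))
      with (fun t => Derive f t * g t + f t * Derive g t).
    + apply Ck_plus; apply IH; try apply Hf; try apply Hg; now apply Ck_le.
    + apply functional_extensionality; intros t; symmetry.
      apply Derive_mult; [apply Hf|apply Hg].
Qed.

Lemma smooth_plus f g : smooth f -> smooth g -> smooth (fun t => f t + g t).
Proof. rewrite !smooth_Ck; intros Hf Hg n; now apply Ck_plus. Qed.

Lemma smooth_mult f g : smooth f -> smooth g -> smooth (fun t => f t * g t).
Proof. rewrite !smooth_Ck; intros Hf Hg n; now apply Ck_mult. Qed.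

Lemma smooth_const c : smooth (fun _ => c).
Proof.
  rewrite smooth_Ck; intros n; revert c; induction n as [|n IH]; intros c; [exact I|].
  split; [intros t; apply ex_derive_const|].
  replace (Derive (fun _ => c)) with (fun _ : R => 0); [apply IH|].
  apply functional_extensionality; intros t; symmetry; apply Derive_const.
Qed.

Lemma smooth_scal c f : smooth f -> smooth (fun t => c * f t).
Proof. intros H. apply smooth_mult; [apply smooth_const|exact H]. Qed.

Lemma smooth_opp f : smooth f -> smooth (fun t => - f t).
Proof.
  intros H. replace (fun t => - f t) with (fun t => -1 * f t); [now apply smooth_scal|].
  apply functional_extensionality; intros t; ring.
Qed.

Lemma smooth_minus f g : smooth f -> smooth g -> smooth (fun t => f t - g t).
Proof. intros Hf Hg. apply smooth_plus; [exact Hf|now apply smooth_opp]. Qed.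

Lemma smooth_div f c : smooth f -> smooth (fun t => f t / c).
Proof. intros H. apply smooth_mult; [exact H|apply smooth_const]. Qed.

Lemma Derive_cos_mult n t : Derive (fun u => cos (n * u)) t = - n * sin (n * t).
Proof. apply is_derive_unique; auto_derive; [easy|ring]. Qed.

Lemma Derive_sin_mult n t : Derive (fun u => sin (n * u)) t = n * cos (n * t).
Proof. apply is_derive_unique; auto_derive; [easy|ring]. Qed.

(** Both coefficients are kept general because this family is stable under [Derive], which is what
    the induction needs. *)
Lemma smooth_trig n c d : smooth (fun t => c * cos (n * t) + d * sin (n * t)).
Proof.
  rewrite smooth_Ck; intros k; revert c d; induction k as [|k IH]; intros c d; [exact I|].
  split; [intros t; auto_derive; easy|].
  replace (Derive (fun t => c * cos (n * t) + d * sin (n * t)))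
    with (fun t => (n * d) * cos (n * t) + (- (n * c)) * sin (n * t)); [apply IH|].
  apply functional_extensionality; intros t; symmetry.
  apply is_derive_unique; auto_derive; [easy|ring].
Qed.

Lemma smooth_cos n : smooth (fun t => cos (n * t)).
Proof.
  replace (fun t => cos (n * t)) with (fun t => 1 * cos (n * t) + 0 * sin (n * t)).
  - apply smooth_trig.
  - apply functional_extensionality; intros t; ring.
Qed.

Lemma smooth_sin n : smooth (fun t => sin (n * t)).
Proof.
  replace (fun t => sin (n * t)) with (fun t => 0 * cos (n * t) + 1 * sin (n * t)).
  - apply smooth_trig.
  - apply functional_extensionality; intros t; ring.
Qed.

Lemma smooth_cos1 : smooth cos.
Proof.
  replace cos with (fun t => cos (1 * t)); [apply smooth_cos|].
  apply functional_extensionality; intros t; f_equal; ring.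
Qed.

Lemma smooth_sin1 : smooth sin.
Proof.
  replace sin with (fun t => sin (1 * t)); [apply smooth_sin|].
  apply functional_extensionality; intros t; f_equal; ring.
Qed.

Lemma smooth_cont f : smooth f -> cont f.
Proof. intros H t. apply (ex_derive_continuous (V := R_NormedModule)). now apply smooth_ex_derive. Qed.

Lemma cont_plus f g : cont f -> cont g -> cont (fun t => f t + g t).
Proof. intros Hf Hg t. now apply (continuous_plus (V := R_NormedModule)). Qed.

Lemma cont_opp f : cont f -> cont (fun t => - f t).
Proof. intros Hf t. now apply (continuous_opp (V := R_NormedModule)). Qed.

Lemma cont_minus f g : cont f -> cont g -> cont (fun t => f t - g t).
Proof. intros Hf Hg t. now apply (continuous_minus (V := R_NormedModule)). Qed.

Lemma cont_mult f g : cont f -> cont g -> cont (fun t => f t * g t).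
Proof. intros Hf Hg t. now apply (continuous_mult (K := R_AbsRing)). Qed.

Lemma cont_const c : cont (fun _ => c).
Proof. intros t. apply continuous_const. Qed.

Lemma cont_pow f n : cont f -> cont (fun t => f t ^ n).
Proof.
  intros H; induction n as [|n IH]; simpl; [apply cont_const|].
  now apply cont_mult.
Qed.

Lemma cont_abs f : cont f -> cont (fun t => Rabs (f t)).
Proof. intros H t. apply (continuous_comp f Rabs); [apply H|apply continuous_Rabs]. Qed.

Lemma cont_div f c : cont f -> cont (fun t => f t / c).
Proof. intros H. apply cont_mult; [exact H|apply cont_const]. Qed.

Create HintDb cont.
#[export] Hint Resolve cont_plus cont_opp cont_minus cont_mult cont_const cont_pow
  cont_abs cont_div : cont.
#[export] Hint Resolve smooth_cont smooth_Derive smooth_opp smooth_minus smooth_div smooth_plus smooth_mult smooth_const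
  smooth_cos smooth_sin smooth_cos1 smooth_sin1 : cont.

Lemma cont_ex_RInt f a b : cont f -> ex_RInt f a b.
Proof. intros H. apply (ex_RInt_continuous (V := R_CompleteNormedModule)). intros; apply H. Qed.

(** * Integration over a period *)

Lemma twopi_pos : 0 < 2 * PI.
Proof. generalize PI_RGT_0; lra. Qed.

Definition circint (f : R -> R) : R := RInt f 0 (2 * PI).

Lemma circint_ext_in f g :
  (forall t, 0 < t < 2 * PI -> f t = g t) -> circint f = circint g.
Proof.
  intros H; apply RInt_ext. rewrite Rmin_left, Rmax_right by (generalize twopi_pos; lra).
  exact H.
Qed.

Lemma circint_ext f g : (forall t, f t = g t) -> circint f = circint g.
Proof. intros H; apply circint_ext_in; intros; apply H. Qed.

Lemma circint_plus f g : cont f -> cont g ->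
  circint (fun t => f t + g t) = circint f + circint g.
Proof.
  intros Hf Hg. apply (RInt_plus (V := R_CompleteNormedModule)); now apply cont_ex_RInt.
Qed.

Lemma circint_scal c f : cont f -> circint (fun t => c * f t) = c * circint f.
Proof.
  intros Hf. apply (RInt_scal (V := R_CompleteNormedModule)); now apply cont_ex_RInt.
Qed.

Lemma circint_const c : circint (fun _ => c) = 2 * PI * c.
Proof. unfold circint. rewrite RInt_const. unfold scal; simpl; unfold mult; simpl. ring. Qed.

Lemma circint_le f g : cont f -> cont g ->
  (forall t, 0 < t < 2 * PI -> f t <= g t) -> circint f <= circint g.
Proof.
  intros Hf Hg H. apply RInt_le; try (now apply cont_ex_RInt); trivial.
  apply Rlt_le, twopi_pos.
Qed.

Lemma circint_ge0 f : cont f -> (forall t, 0 < t < 2 * PI -> 0 <= f t) -> 0 <= circint f.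
Proof.
  intros Hf H. replace 0 with (circint (fun _ => 0)).
  - apply circint_le; trivial. apply cont_const.
  - rewrite circint_const; ring.
Qed.

Lemma circint_abs_le f g : cont f -> cont g ->
  (forall t, 0 < t < 2 * PI -> Rabs (f t) <= g t) -> Rabs (circint f) <= circint g.
Proof.
  intros Hf Hg H.
  assert (H1 : circint f <= circint g).
  { apply circint_le; trivial. intros t Ht. generalize (Rle_abs (f t)) (H t Ht); lra. }
  assert (H2 : circint (fun t => - 1 * f t) <= circint g).
  { apply circint_le; auto with cont. intros t Ht.
    generalize (Rle_abs (- f t)) (H t Ht); rewrite Rabs_Ropp; lra. }
  rewrite circint_scal in H2 by trivial.
  apply Rabs_le; lra.
Qed.

Lemma periodic_Derive f : periodic f -> periodic (Derive f).
Proof.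
  intros H t. unfold Derive. apply f_equal, Lim_ext. intros h.
  replace (t + 2 * PI + h) with (t + h + 2 * PI) by ring. now rewrite !H.
Qed.

Lemma periodic_0 (f : R -> R) : periodic f -> f (2 * PI) = f 0.
Proof. intros H. rewrite <- (H 0). f_equal; ring. Qed.

Lemma circint_Derive f : smooth f -> periodic f -> circint (Derive f) = 0.
Proof.
  intros Hs Hp. unfold circint. rewrite RInt_Derive.
  - rewrite (periodic_0 f Hp); ring.
  - intros; now apply smooth_ex_derive.
  - intros; now apply smooth_cont, smooth_Derive.
Qed.

Lemma circint_parts f g : smooth f -> periodic f -> smooth g -> periodic g ->
  circint (fun t => Derive f t * g t) = - circint (fun t => f t * Derive g t).
Proof.
  intros Hf Pf Hg Pg.
  assert (H : circint (Derive (fun t => f t * g t)) = 0).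
  { apply circint_Derive; [now apply smooth_mult|].
    intros t; simpl; now rewrite Pf, Pg. }
  rewrite (circint_ext _ (fun t => Derive f t * g t + f t * Derive g t)) in H.
  2: intros t; apply Derive_mult; now apply smooth_ex_derive.
  rewrite circint_plus in H; auto with cont. lra.
Qed.

Lemma periodic_cos n : periodic (fun t => cos (INR n * t)).
Proof.
  intros t. replace (INR n * (t + 2 * PI)) with (INR n * t + 2 * INR n * PI) by ring.
  apply cos_period.
Qed.

Lemma periodic_sin n : periodic (fun t => sin (INR n * t)).
Proof.
  intros t. replace (INR n * (t + 2 * PI)) with (INR n * t + 2 * INR n * PI) by ring.
  apply sin_period.
Qed.

Lemma periodic_cos1 : periodic cos.
Proof. intros t. rewrite <- (cos_period t 1). f_equal; simpl; ring. Qed.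

Lemma periodic_sin1 : periodic sin.
Proof. intros t. rewrite <- (sin_period t 1). f_equal; simpl; ring. Qed.

Lemma periodic_representative t : exists s, 0 <= s < 2 * PI /\
  forall f : R -> R, periodic f -> f t = f s.
Proof.
  assert (Hpi := twopi_pos).
  assert (HZ : forall (f : R -> R), periodic f -> forall (k : nat) u, f (u + 2 * INR k * PI) = f u).
  { intros f Pf; induction k as [|k IH]; intros u.
    - simpl. f_equal; ring.
    - rewrite S_INR. replace (u + 2 * (INR k + 1) * PI) with (u + 2 * INR k * PI + 2 * PI) by ring.
      now rewrite Pf. }
  assert (Hpos : forall u, 0 <= u -> exists s, 0 <= s < 2 * PI /\
    forall f : R -> R, periodic f -> f u = f s).
  { intros u Hu. destruct (nfloor_ex (u / (2 * PI))) as [k Hk].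
    { apply Rmult_le_pos; [easy|]. now apply Rlt_le, Rinv_0_lt_compat. }
    exists (u - 2 * INR k * PI). split.
    - assert (Hu' : u = u / (2 * PI) * (2 * PI)) by (field; lra). nra.
    - intros f Pf. rewrite <- (HZ f Pf k (u - _)). f_equal; ring. }
  destruct (Rle_dec 0 t) as [|Hn]; [now apply Hpos|].
  (* The natural floor wants a nonnegative argument; adding [k + 1] periods moves a negative [t] to
     the side already treated. *)
  destruct (nfloor_ex (- t / (2 * PI))) as [k Hk].
  { apply Rmult_le_pos; [lra|]. now apply Rlt_le, Rinv_0_lt_compat. }
  destruct (Hpos (t + 2 * INR (S k) * PI)) as (s & Hs & Hf).
  - assert (Ht' : - t = - t / (2 * PI) * (2 * PI)) by (field; lra).
    rewrite S_INR. nra.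
  - exists s. split; [easy|]. intros f Pf. rewrite <- Hf by easy. now rewrite HZ.
Qed.

Lemma periodic_bounded f : cont f -> periodic f -> exists B, forall t, Rabs (f t) <= B.
Proof.
  intros Cf Pf. assert (Hpi := twopi_pos).
  destruct (continuity_ab_maj (fun t => Rabs (f t)) 0 (2 * PI)) as (M & HM & _); [lra| |].
  - intros c _. apply continuity_pt_filterlim. now apply cont_abs.
  - exists (Rabs (f M)). intros t. destruct (periodic_representative t) as (s & Hs & Hfs).
    rewrite (Hfs f Pf). apply HM. lra.
Qed.

(** * Fourier series *)

(** The index starts at 1: the constant term of a Fourier sum carries a factor 1/2 and is written
    apart. *)
Fixpoint psum (F : nat -> R) (n : nat) : R :=
  match n with
  | O => 0
  | S m => psum F m + F (S m)
  end.

Lemma cont_psum (F : nat -> R -> R) n :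
  (forall k, cont (F k)) -> cont (fun t => psum (fun k => F k t) n).
Proof. intros H; induction n as [|n IH]; simpl; auto with cont. Qed.

Lemma circint_mult_psum f (F : nat -> R -> R) n : cont f -> (forall k, cont (F k)) ->
  circint (fun t => f t * psum (fun k => F k t) n)
  = psum (fun k => circint (fun t => f t * F k t)) n.
Proof.
  intros Hf HF; induction n as [|n IH]; simpl.
  - rewrite (circint_ext _ (fun _ => 0)) by (intros; ring). rewrite circint_const; ring.
  - rewrite (circint_ext _ (fun t => f t * psum (fun k => F k t) n + f t * F (S n) t))
      by (intros; ring).
    rewrite circint_plus, IH; auto using cont_mult, cont_psum.
Qed.

Lemma psum_ext F G n : (forall k, (1 <= k)%nat -> F k = G k) -> psum F n = psum G n.
Proof. intros H; induction n as [|n IH]; simpl; [easy|]. rewrite IH, H; [easy|lia]. Qed.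

Lemma psum_scal c F n : psum (fun k => c * F k) n = c * psum F n.
Proof. induction n as [|n IH]; simpl; [ring|rewrite IH; ring]. Qed.

Lemma psum_ge0 F n : (forall k, 0 <= F k) -> 0 <= psum F n.
Proof. intros H; induction n as [|n IH]; simpl; [lra|generalize (H (S n)); lra]. Qed.

Lemma INR_S_neq0 n : INR (S n) <> 0.
Proof. apply not_0_INR; lia. Qed.

Lemma circint_cos n : (1 <= n)%nat -> circint (fun t => cos (INR n * t)) = 0.
Proof.
  intros Hn. assert (H0 : INR n <> 0) by (apply not_0_INR; lia).
  rewrite (circint_ext _ (fun t => / INR n * Derive (fun u => sin (INR n * u)) t)).
  - rewrite circint_scal by auto with cont.
    rewrite circint_Derive; auto using smooth_sin, periodic_sin. ring.
  - intros t. rewrite Derive_sin_mult. now field.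
Qed.

Lemma circint_sin n : circint (fun t => sin (INR n * t)) = 0.
Proof.
  destruct n as [|n].
  - rewrite (circint_ext _ (fun _ => 0)).
    + rewrite circint_const; ring.
    + intros t. simpl. rewrite Rmult_0_l. apply sin_0.
  - rewrite (circint_ext _ (fun t => - / INR (S n) * Derive (fun u => cos (INR (S n) * u)) t)).
    + rewrite circint_scal by auto with cont.
      rewrite circint_Derive; auto using smooth_cos, periodic_cos. ring.
    + intros t. rewrite Derive_cos_mult. field. apply INR_S_neq0.
Qed.

Lemma cos_shift_expand n s t :
  cos (n * (t - s)) = cos (n * s) * cos (n * t) + sin (n * s) * sin (n * t).
Proof. rewrite Rmult_minus_distr_l, cos_minus; ring. Qed.

Lemma cont_cos_shift n s : cont (fun t => cos (n * (t - s))).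
Proof.
  intros t. apply (ex_derive_continuous (V := R_NormedModule)). auto_derive; easy.
Qed.

Lemma cont_sin_shift n s : cont (fun t => sin (n * (t - s))).
Proof.
  intros t. apply (ex_derive_continuous (V := R_NormedModule)). auto_derive; easy.
Qed.

#[export] Hint Resolve cont_cos_shift cont_sin_shift cont_psum : cont.

Lemma circint_cos_shift n s :
  (1 <= n)%nat -> circint (fun t => cos (INR n * (t - s))) = 0.
Proof.
  intros Hn.
  rewrite (circint_ext _ (fun t => cos (INR n * s) * cos (INR n * t)
                                 + sin (INR n * s) * sin (INR n * t)))
    by (intros; apply cos_shift_expand).
  rewrite circint_plus, !circint_scal, circint_cos, circint_sin; auto with cont. ring.
Qed.

(** Telescoping of [2 sin (u/2) cos (k u) = sin ((k + 1/2) u) - sin ((k - 1/2) u)]. Left undivided,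
    the identity also holds where [sin (u/2)] vanishes. *)
Lemma dirichlet_kernel n u :
  2 * sin (u / 2) * (/ 2 + psum (fun k => cos (INR k * u)) n) = sin ((INR n + / 2) * u).
Proof.
  induction n as [|n IH].
  - simpl. replace ((0 + / 2) * u) with (u / 2) by field. field.
  - cbn [psum].
    replace (2 * sin (u / 2) * (/ 2 + (psum (fun k => cos (INR k * u)) n + cos (INR (S n) * u))))
      with (2 * sin (u / 2) * (/ 2 + psum (fun k => cos (INR k * u)) n)
            + 2 * sin (u / 2) * cos (INR (S n) * u)) by ring.
    rewrite IH, S_INR.
    replace ((INR n + / 2) * u) with ((INR n + 1) * u - u / 2) by field.
    replace ((INR n + 1 + / 2) * u) with ((INR n + 1) * u + u / 2) by field.
    rewrite sin_minus, sin_plus. ring.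
Qed.

Lemma bessel (phi : nat -> R -> R) g :
  (forall k, cont (phi k)) ->
  (forall k, circint (fun t => phi k t * phi k t) = PI) ->
  (forall k m, (k < m)%nat -> circint (fun t => phi k t * phi m t) = 0) ->
  cont g ->
  forall n, psum (fun k => circint (fun t => g t * phi k t) ^ 2) n
            <= PI * circint (fun t => g t ^ 2).
Proof.
  intros Cphi Hn Ho Cg n. generalize PI_RGT_0; intros Hpi.
  (* [G] is [g] minus its projection on the first [n] functions. Orthogonality leaves the later
     coefficients unchanged, and Pythagoras gives its norm; that this norm is nonnegative is the
     inequality. *)
  assert (H : exists G, cont G /\
    (forall m, (n < m)%nat -> circint (fun t => G t * phi m t) = circint (fun t => g t * phi m t)) /\
    PI * circint (fun t => G t ^ 2) = PI * circint (fun t => g t ^ 2)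
      - psum (fun k => circint (fun t => g t * phi k t) ^ 2) n).
  { induction n as [|n (G & CG & HG & HI)].
    - exists g. repeat split; trivial. simpl; ring.
    - set (c := circint (fun t => g t * phi (S n) t) / PI).
      exists (fun t => G t + - c * phi (S n) t). split; [auto with cont|]. split.
      + intros m Hm.
        rewrite (circint_ext _ (fun t => G t * phi m t + - c * (phi (S n) t * phi m t)))
          by (intros; ring).
        rewrite circint_plus, circint_scal, HG, Ho; auto with cont; try lia. ring.
      + rewrite (circint_ext _ (fun t => (G t ^ 2 + (- 2 * c) * (G t * phi (S n) t))
                                         + c ^ 2 * (phi (S n) t * phi (S n) t)))
          by (intros; ring).
        rewrite !circint_plus, !circint_scal, HG, Hn; auto 7 with cont; try lia.
        cbn [psum].
        replace (PI * (circint (fun t => G t ^ 2) + -2 * c * circint (fun t => g t * phi (S n) t) + c ^ 2 * PI))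
          with (PI * circint (fun t => G t ^ 2) + PI * (-2 * c * circint (fun t => g t * phi (S n) t) + c ^ 2 * PI)) by ring.
        rewrite HI. unfold c. field. lra. }
  destruct H as (G & CG & _ & HI).
  assert (0 <= circint (fun t => G t ^ 2)).
  { apply circint_ge0; auto with cont. intros; apply pow2_ge_0. }
  nra.
Qed.

(** Otherwise all squares from [n] on would be at least [eps ^ 2] and their sum unbounded.
    Infinitely many small terms suffice later, so convergence to 0 is not extracted. *)
Lemma psum_sqr_bounded_small e K : (forall n, psum (fun k => e k ^ 2) n <= K) ->
  forall eps, 0 < eps -> forall n, exists m, (n <= m)%nat /\ Rabs (e m) < eps.
Proof.
  intros H eps Heps n.
  destruct (classic (exists m, (n <= m)%nat /\ Rabs (e m) < eps)) as [|Hno]; trivial.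
  exfalso.
  assert (Hge : forall m, (n <= m)%nat -> eps ^ 2 <= e m ^ 2).
  { intros m Hm. rewrite <- (pow2_abs (e m)). apply pow_incr. split; [lra|].
    apply Rnot_lt_le. intros Hlt. apply Hno. now exists m. }
  assert (Hs : forall j, INR j * eps ^ 2 <= psum (fun k => e k ^ 2) (n + j)).
  { induction j as [|j IH].
    - rewrite Nat.add_0_r. simpl INR. rewrite Rmult_0_l.
      apply psum_ge0; intros; apply pow2_ge_0.
    - rewrite Nat.add_succ_r. cbn [psum]. rewrite S_INR.
      assert (Hle : (n <= S (n + j))%nat) by lia. generalize (Hge _ Hle); lra. }
  assert (He : 0 < eps ^ 2) by (apply pow_lt; lra).
  destruct (INR_unbounded (K / eps ^ 2)) as [j Hj].
  generalize (Hs j) (H (n + j)%nat); intros.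
  apply (Rmult_lt_compat_r (eps ^ 2)) in Hj; [|easy].
  unfold Rdiv in Hj. rewrite Rmult_assoc, Rinv_l in Hj by lra. lra.
Qed.

(** The derivative on the diagonal fills the removable singularity, so that the quotient is
    continuous in [t]. *)
Definition slope (f : R -> R) (s t : R) : R :=
  if Req_EM_T t s then Derive f s else (f t - f s) / (t - s).

Lemma slope_spec f s t : f t - f s = (t - s) * slope f s t.
Proof.
  unfold slope. destruct (Req_EM_T t s) as [->|H]; [ring|field; lra].
Qed.

Lemma slope_cont f s : (forall t, ex_derive f t) -> cont (slope f s).
Proof.
  intros Hf t. destruct (Req_EM_T t s) as [->|Hne].
  - apply continuity_pt_filterlim.
    assert (Hd : derivable_pt_lim f s (Derive f s)).
    { apply is_derive_Reals, Derive_correct, Hf. }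
    intros eps Heps. destruct (Hd eps Heps) as [delta Hdelta].
    exists delta. split; [apply cond_pos|].
    intros x [[_ Hx] Hdist]. unfold dist in *; simpl in *; unfold R_dist in *.
    unfold slope. destruct (Req_EM_T s s) as [_|]; [|easy].
    destruct (Req_EM_T x s) as [->|Hxs]; [rewrite Rminus_diag, Rabs_R0; lra|].
    assert (Hxs' : x - s <> 0) by lra.
    generalize (Hdelta (x - s) Hxs' Hdist).
    now replace (s + (x - s)) with x by ring.
  - apply (continuous_ext_loc _ (fun u => (f u - f s) / (u - s))).
    + assert (Hp : 0 < Rabs (t - s)) by (apply Rabs_pos_lt; lra).
      exists (mkposreal _ Hp). intros u Hu.
      unfold ball in Hu; simpl in Hu; unfold AbsRing_ball, abs, minus, plus, opp in Hu; simpl in Hu.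
      unfold slope. destruct (Req_EM_T u s) as [->|]; [|easy].
      replace (s + - t) with (- (t - s)) in Hu by ring. rewrite Rabs_Ropp in Hu. lra.
    + apply (ex_derive_continuous (V := R_NormedModule)). auto_derive.
      repeat split; trivial. lra.
Qed.

Definition fourier_sum (f : R -> R) (n : nat) (s : R) : R :=
  cos_coef f 0 / 2
  + psum (fun k => cos_coef f k * cos (INR k * s) + sin_coef f k * sin (INR k * s)) n.

Lemma cos_coefE f n : cos_coef f n = circint (fun t => f t * cos (INR n * t)) / PI.
Proof. reflexivity. Qed.

Lemma sin_coefE f n : sin_coef f n = circint (fun t => f t * sin (INR n * t)) / PI.
Proof. reflexivity. Qed.

Lemma cos_coef_0 f : cos_coef f 0 = circint f / PI.
Proof.
  rewrite cos_coefE. f_equal. apply circint_ext. intros t. simpl.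
  rewrite Rmult_0_l, cos_0; ring.
Qed.

Lemma fourier_sum_integral f n s : cont f ->
  PI * fourier_sum f n s
  = circint (fun t => f t * (/ 2 + psum (fun k => cos (INR k * (t - s))) n)).
Proof.
  intros Cf. generalize PI_RGT_0; intros Hpi.
  rewrite (circint_ext _ (fun t => / 2 * f t + f t * psum (fun k => cos (INR k * (t - s))) n))
    by (intros; ring).
  rewrite circint_plus, circint_scal by auto with cont.
  rewrite (circint_mult_psum f (fun k t => cos (INR k * (t - s)))) by auto with cont.
  unfold fourier_sum. rewrite cos_coef_0, Rmult_plus_distr_l, <- psum_scal.
  f_equal; [field; lra|]. apply psum_ext. intros k _.
  rewrite (circint_ext _ (fun t => cos (INR k * s) * (f t * cos (INR k * t))
                                   + sin (INR k * s) * (f t * sin (INR k * t))))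
    by (intros; rewrite cos_shift_expand; ring).
  rewrite circint_plus, !circint_scal by auto with cont.
  rewrite cos_coefE, sin_coefE. field. lra.
Qed.

(** The mass of the kernel is what allows [f s] to be subtracted under the integral sign. *)
Lemma circint_dirichlet n s :
  circint (fun t => / 2 + psum (fun k => cos (INR k * (t - s))) n) = PI.
Proof.
  rewrite (circint_ext _ (fun t => / 2 + 1 * psum (fun k => cos (INR k * (t - s))) n))
    by (intros; ring).
  rewrite circint_plus, circint_const by auto with cont.
  rewrite (circint_mult_psum (fun _ => 1) (fun k t => cos (INR k * (t - s)))) by auto with cont.
  rewrite (psum_ext _ (fun _ => 0 * 0)).
  - rewrite psum_scal. field.
  - intros k Hk. rewrite circint_scal, circint_cos_shift; auto with cont. ring.
Qed.

(** These sines change sign over a period of length [2 PI], but the product of two of them is a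
    combination of cosines of integer frequency; hence they are orthogonal. *)
Definition half_sine (s : R) (k : nat) (t : R) : R := sin ((INR k + / 2) * (t - s)).

Lemma sin_mult_sin x y : sin x * sin y = / 2 * cos (x - y) + (- / 2) * cos (x + y).
Proof. rewrite cos_minus, cos_plus; field. Qed.

Lemma half_sine_norm s k : circint (fun t => half_sine s k t * half_sine s k t) = PI.
Proof.
  rewrite (circint_ext _ (fun t => / 2 + (- / 2) * cos (INR (2 * k + 1) * (t - s)))).
  - rewrite circint_plus, circint_scal, circint_const, circint_cos_shift; auto with cont; try lia.
    field.
  - intros t. unfold half_sine. rewrite sin_mult_sin.
    rewrite Rminus_diag, cos_0, plus_INR, mult_INR. simpl INR. f_equal; [ring|]. do 2 f_equal. field.
Qed.

Lemma half_sine_orth s k m : (k < m)%nat ->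
  circint (fun t => half_sine s k t * half_sine s m t) = 0.
Proof.
  intros Hkm.
  rewrite (circint_ext _ (fun t => / 2 * cos (INR (m - k) * (t - s))
                                   + (- / 2) * cos (INR (k + m + 1) * (t - s)))).
  - rewrite circint_plus, !circint_scal, !circint_cos_shift; auto with cont; try lia. field.
  - intros t. unfold half_sine. rewrite Rmult_comm, sin_mult_sin.
    rewrite minus_INR, !plus_INR by lia. simpl INR. f_equal; do 2 f_equal; field.
Qed.

(** For [s] strictly inside the period, [(t - s) / 2] stays strictly between [- PI] and [PI], so the
    sine vanishes only at [t = s], where the slope is 1. At an endpoint [s] it would vanish at the
    other end as well. *)
Lemma chord_slope_neq0 s t : 0 < s < 2 * PI -> 0 <= t <= 2 * PI ->
  slope (fun u => 2 * sin ((u - s) / 2)) s t <> 0.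
Proof.
  intros Hs Ht. unfold slope. destruct (Req_EM_T t s) as [_|Hne].
  - replace (Derive _ s) with 1; [lra|]. symmetry. apply is_derive_unique. auto_derive; [easy|].
    replace ((s + - s) * / 2) with 0 by field. rewrite cos_0. field.
  - rewrite Rminus_diag. replace (0 / 2) with 0 by field. rewrite sin_0.
    unfold Rdiv at 1. apply Rmult_integral_contrapositive_currified; [|apply Rinv_neq_0_compat; lra].
    destruct (Rlt_le_dec s t).
    + assert (0 < sin ((t - s) / 2)) by (apply sin_gt_0; lra). lra.
    + assert (sin ((t - s) / 2) < 0) by (apply sin_lt_0_var; lra). lra.
Qed.

(** The quotient by the chord is continuous on one period only, since the chord vanishes again at
    distance [2 PI] from [s]. Composition with [clamp] makes it continuous everywhere without
    changing integrals over the period. *)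
Definition clamp (t : R) : R := Rmax 0 (Rmin t (2 * PI)).

Lemma clamp_range t : 0 <= clamp t <= 2 * PI.
Proof.
  generalize twopi_pos; intros. unfold clamp, Rmax, Rmin.
  repeat destruct (Rle_dec _ _); lra.
Qed.

Lemma clamp_id t : 0 < t < 2 * PI -> clamp t = t.
Proof. intros. unfold clamp, Rmax, Rmin. repeat destruct (Rle_dec _ _); lra. Qed.

Lemma clamp_cont : cont clamp.
Proof.
  intros t. apply continuity_pt_filterlim. intros eps Heps. exists eps. split; [easy|].
  intros x [_ Hx]. unfold dist in *; simpl in *; unfold R_dist in *.
  apply Rle_lt_trans with (2 := Hx). unfold clamp, Rmax, Rmin.
  unfold Rabs. repeat destruct (Rle_dec _ _); repeat destruct (Rcase_abs _); lra.
Qed.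

(* Chernoff's argument: dividing [f t - f s] by [2 sin ((t - s) / 2)] turns the remainder of
   the Fourier sum at [s] into the coefficients of a continuous function in an orthogonal
   system, and these are square-summable. *)
Lemma fourier_remainder f s : smooth f -> 0 < s < 2 * PI ->
  exists (e : nat -> R) (K : R),
    (forall n, psum (fun k => e k ^ 2) n <= K) /\
    (forall n, PI * (fourier_sum f n s - f s) = e n).
Proof.
  intros Hf Hs.
  set (h := fun t => slope f s t / slope (fun u => 2 * sin ((u - s) / 2)) s t).
  set (g := fun t => h (clamp t)).
  assert (Cg : cont g).
  { intros t. apply (continuous_comp clamp h); [apply clamp_cont|].
    apply (continuous_mult (K := R_AbsRing)).
    - apply slope_cont. intros; now apply smooth_ex_derive.
    - apply continuous_Rinv_comp.
      + apply slope_cont. intros u; auto_derive; easy.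
      + apply chord_slope_neq0; [easy|apply clamp_range]. }
  exists (fun n => circint (fun t => g t * half_sine s n t)), (PI * circint (fun t => g t ^ 2)).
  split.
  - apply (bessel (half_sine s)); trivial.
    + intros k; apply cont_sin_shift.
    + apply half_sine_norm.
    + apply half_sine_orth.
  - intros n. rewrite Rmult_minus_distr_l, fourier_sum_integral by auto with cont.
    (* Writing [PI] as the integral of the kernel puts [f s] under the same integral, where only
       [f t - f s] remains. *)
    rewrite <- (circint_dirichlet n s) at 1.
    rewrite (Rmult_comm _ (f s)), <- circint_scal by auto with cont.
    match goal with |- ?X - circint ?F = _ =>
      replace (X - circint F) with (X + -1 * circint F) by ring end.
    rewrite <- circint_scal by auto 7 with cont.
    rewrite <- circint_plus by auto 8 with cont.
    apply circint_ext_in. intros t Ht. unfold half_sine. rewrite <- dirichlet_kernel.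
    assert (Hft : f t - f s = 2 * sin ((t - s) / 2) * g t).
    { rewrite slope_spec. unfold g. rewrite clamp_id by easy.
      generalize (slope_spec (fun u => 2 * sin ((u - s) / 2)) s t). simpl.
      rewrite Rminus_diag. replace (0 / 2) with 0 by field.
      rewrite sin_0, Rmult_0_r, Rminus_0_r. intros ->.
      unfold h. field. apply chord_slope_neq0; [easy|lra]. }
    match goal with |- _ = g t * (_ * ?D) =>
      replace (g t * (2 * sin ((t - s) / 2) * D)) with ((2 * sin ((t - s) / 2) * g t) * D) by ring end.
    rewrite <- Hft. ring.
Qed.

(** * Rate of convergence, uniqueness and positivity *)

Lemma cos_coef_Derive f n : smooth f -> periodic f ->
  cos_coef (Derive f) n = INR n * sin_coef f n.
Proof.
  intros Hf Pf. rewrite cos_coefE, sin_coefE, circint_parts by auto using smooth_cos, periodic_cos.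
  rewrite (circint_ext _ (fun t => - INR n * (f t * sin (INR n * t))))
    by (intros; rewrite Derive_cos_mult; ring).
  rewrite circint_scal by auto with cont. generalize PI_RGT_0; intros; field; lra.
Qed.

Lemma sin_coef_Derive f n : smooth f -> periodic f ->
  sin_coef (Derive f) n = - INR n * cos_coef f n.
Proof.
  intros Hf Pf. rewrite cos_coefE, sin_coefE, circint_parts by auto using smooth_sin, periodic_sin.
  rewrite (circint_ext _ (fun t => INR n * (f t * cos (INR n * t))))
    by (intros; rewrite Derive_sin_mult; ring).
  rewrite circint_scal by auto with cont. generalize PI_RGT_0; intros; field; lra.
Qed.

Lemma trig_coef_bound f n s : cont f ->
  Rabs (cos_coef f n * cos (INR n * s) + sin_coef f n * sin (INR n * s))
  <= circint (fun t => Rabs (f t)) / PI.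
Proof.
  intros Cf. generalize PI_RGT_0; intros Hpi.
  replace (cos_coef f n * cos (INR n * s) + sin_coef f n * sin (INR n * s))
    with (circint (fun t => f t * cos (INR n * (t - s))) / PI).
  - unfold Rdiv. rewrite Rabs_mult, (Rabs_pos_eq (/ PI)) by (apply Rlt_le, Rinv_0_lt_compat; lra).
    apply Rmult_le_compat_r; [apply Rlt_le, Rinv_0_lt_compat; lra|].
    apply circint_abs_le; auto with cont. intros t _. rewrite Rabs_mult.
    rewrite <- (Rmult_1_r (Rabs (f t))) at 2. apply Rmult_le_compat_l; [apply Rabs_pos|].
    apply Rabs_le, COS_bound.
  - rewrite (circint_ext _ (fun t => cos (INR n * s) * (f t * cos (INR n * t))
                                   + sin (INR n * s) * (f t * sin (INR n * t))))
      by (intros; rewrite cos_shift_expand; ring).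
    rewrite circint_plus, !circint_scal by auto with cont.
    rewrite cos_coefE, sin_coefE. field. lra.
Qed.

(** Two integrations by parts turn the coefficients of [f] into those of [f''] divided by the square
    of the frequency. *)
Lemma fourier_sum_increment f n s : smooth f -> periodic f ->
  Rabs (fourier_sum f (S n) s - fourier_sum f n s)
  <= circint (fun t => Rabs (Derive (Derive f) t)) / PI / INR (S n) ^ 2.
Proof.
  intros Hf Pf. generalize (INR_S_neq0 n); intros Hn.
  assert (Hp : 0 < INR (S n) ^ 2) by (apply pow2_gt_0; easy).
  unfold fourier_sum. cbn [psum].
  match goal with |- Rabs ?X <= _ => replace X with
    (- ((cos_coef (Derive (Derive f)) (S n) * cos (INR (S n) * s)
        + sin_coef (Derive (Derive f)) (S n) * sin (INR (S n) * s)) / INR (S n) ^ 2)) end.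
  - rewrite Rabs_Ropp. unfold Rdiv at 1. rewrite Rabs_mult, (Rabs_pos_eq (/ _)).
    + apply Rmult_le_compat_r; [now apply Rlt_le, Rinv_0_lt_compat|].
      apply trig_coef_bound; auto with cont.
    + now apply Rlt_le, Rinv_0_lt_compat.
  - rewrite cos_coef_Derive, !sin_coef_Derive, cos_coef_Derive
      by auto using smooth_Derive, periodic_Derive.
    field. easy.
Qed.

(** The increments are compared with [1/m - 1/(m + 1)]. Keeping both ends of the telescoping sum,
    instead of [/ INR (S n)] alone, makes the induction on [j] close. *)
Lemma fourier_sum_dist f n j s : smooth f -> periodic f ->
  Rabs (fourier_sum f (S n + j) s - fourier_sum f (S n) s)
  <= circint (fun t => Rabs (Derive (Derive f) t)) / PI * (/ INR (S n) - / INR (S n + j)).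
Proof.
  intros Hf Pf. generalize PI_RGT_0; intros Hpi.
  set (M := circint (fun t => Rabs (Derive (Derive f) t)) / PI).
  assert (HM : 0 <= M).
  { apply Rmult_le_pos; [|now apply Rlt_le, Rinv_0_lt_compat].
    apply circint_ge0; auto with cont. intros; apply Rabs_pos. }
  induction j as [|j IH].
  - rewrite Nat.add_0_r, !Rminus_diag, Rabs_R0. lra.
  - rewrite Nat.add_succ_r.
    set (m := (S n + j)%nat) in *.
    assert (Hm : 1 <= INR m) by (apply (le_INR 1); unfold m; lia).
    replace (fourier_sum f (S m) s - fourier_sum f (S n) s) with
      ((fourier_sum f (S m) s - fourier_sum f m s) + (fourier_sum f m s - fourier_sum f (S n) s)) by ring.
    eapply Rle_trans; [apply Rabs_triang|].
    generalize (fourier_sum_increment f m s Hf Pf). fold M. intros H1.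
    assert (H2 : M / INR (S m) ^ 2 <= M * (/ INR m - / INR (S m))).
    { unfold Rdiv. apply Rmult_le_compat_l; [easy|]. rewrite S_INR.
      replace (/ INR m - / (INR m + 1)) with (/ (INR m * (INR m + 1))) by (field; lra).
      apply Rinv_le_contravar; nra. }
    lra.
Qed.

(** The tail estimate only says that the sums are Cauchy, with a rate uniform in [s]. The limit is
    identified by the square-summable remainder, which is small for infinitely many [m]. *)
Lemma fourier_sum_close f n s : smooth f -> periodic f -> 0 < s < 2 * PI ->
  Rabs (f s - fourier_sum f (S n) s)
  <= circint (fun t => Rabs (Derive (Derive f) t)) / PI / INR (S n).
Proof.
  intros Hf Pf Hs. generalize PI_RGT_0; intros Hpi.
  destruct (fourier_remainder f s Hf Hs) as (e & K & He & Hr).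
  set (M := circint (fun t => Rabs (Derive (Derive f) t)) / PI).
  assert (HM : 0 <= M).
  { apply Rmult_le_pos; [|now apply Rlt_le, Rinv_0_lt_compat].
    apply circint_ge0; auto with cont. intros; apply Rabs_pos. }
  apply Rnot_lt_le. intros Hlt.
  (* The excess over the claimed bound; an index [m] beyond [n] with remainder below it gives the
     contradiction. *)
  set (eps := Rabs (f s - fourier_sum f (S n) s) - M / INR (S n)).
  destruct (psum_sqr_bounded_small e K He (PI * eps)) with (n := S n) as (m & Hm & Hem).
  { apply Rmult_lt_0_compat; unfold eps; lra. }
  rewrite <- Hr, Rabs_mult, (Rabs_pos_eq PI) in Hem by lra.
  apply Rmult_lt_reg_l in Hem; [|easy].
  replace m with (S n + (m - S n))%nat in Hem by lia.
  generalize (fourier_sum_dist f n (m - S n) s Hf Pf). fold M. intros Hd.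
  assert (Hi : 0 < / INR (S n + (m - S n))).
  { apply Rinv_0_lt_compat, lt_0_INR. lia. }
  assert (Ht := Rabs_triang (f s - fourier_sum f (S n + (m - S n)) s)
                  (fourier_sum f (S n + (m - S n)) s - fourier_sum f (S n) s)).
  replace (f s - fourier_sum f (S n + (m - S n)) s +
    (fourier_sum f (S n + (m - S n)) s - fourier_sum f (S n) s))
    with (f s - fourier_sum f (S n) s) in Ht by ring.
  rewrite Rabs_minus_sym in Hem. unfold eps, Rdiv in Hem. nra.
Qed.

(** All Fourier sums vanish, so the remainder is the constant [- PI * f s], and a constant sequence
    with bounded sums of squares is 0. This settles interior points; the endpoint follows by
    continuity and the rest by periodicity. *)
Lemma fourier_unique f : smooth f -> periodic f ->
  (forall n, cos_coef f n = 0) -> (forall n, sin_coef f n = 0) -> forall t, f t = 0.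
Proof.
  intros Hf Pf Hc Hsn.
  assert (Hin : forall s, 0 < s < 2 * PI -> f s = 0).
  { intros s Hs.
    destruct (fourier_remainder f s Hf Hs) as (e & K & He & Hr).
    assert (HS : forall n, fourier_sum f n s = 0).
    { intros n. unfold fourier_sum. rewrite Hc, (psum_ext _ (fun _ => 0 * 0)).
      - rewrite psum_scal. field.
      - intros k _. rewrite Hc, Hsn. ring. }
    generalize PI_RGT_0; intros Hpi.
    destruct (Req_dec (f s) 0) as [|Hne]; trivial. exfalso.
    destruct (psum_sqr_bounded_small e K He (PI * Rabs (f s))) with (n := 0%nat) as (m & _ & Hm).
    - apply Rmult_lt_0_compat; [easy|now apply Rabs_pos_lt].
    - rewrite <- Hr, HS, Rminus_0_l, Rabs_mult, Rabs_Ropp, (Rabs_pos_eq PI) in Hm; lra. }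
  assert (H0 : f 0 = 0).
  { destruct (Req_dec (f 0) 0) as [|Hne]; trivial. exfalso.
    assert (Hc0 : continuity_pt f 0) by (apply continuity_pt_filterlim, smooth_cont, Hf).
    destruct (Hc0 (Rabs (f 0))) as (d & Hd & Hd'); [now apply Rabs_pos_lt|].
    generalize twopi_pos; intros Hpi.
    set (x := Rmin (d / 2) PI).
    assert (Hx : 0 < x < 2 * PI /\ x < d).
    { unfold x, Rmin. destruct (Rle_dec _ _); lra. }
    assert (HH : Rabs (f x - f 0) < Rabs (f 0)).
    { apply (Hd' x). split; [split; [exact I|lra]|].
      unfold dist; simpl; unfold R_dist. rewrite Rminus_0_r, Rabs_pos_eq; lra. }
    rewrite (Hin x), Rminus_0_l, Rabs_Ropp in HH; lra. }
  intros t. destruct (periodic_representative t) as (s & Hs & Hfs). rewrite (Hfs f Pf).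
  destruct (Req_dec s 0) as [->|]; [easy|]. apply Hin; lra.
Qed.

Lemma circint_mult_fourier_sum h f n : cont h ->
  circint (fun t => h t * fourier_sum f n t)
  = PI * (cos_coef h 0 * cos_coef f 0 / 2
          + psum (fun k => cos_coef h k * cos_coef f k + sin_coef h k * sin_coef f k) n).
Proof.
  intros Ch. generalize PI_RGT_0; intros Hpi.
  rewrite (circint_ext _ (fun t => cos_coef f 0 / 2 * h t + h t * psum (fun k =>
    cos_coef f k * cos (INR k * t) + sin_coef f k * sin (INR k * t)) n))
    by (intros; unfold fourier_sum; ring).
  assert (Ck : forall k, cont (fun t => cos_coef f k * cos (INR k * t) + sin_coef f k * sin (INR k * t)))
    by auto with cont.
  rewrite circint_plus, circint_scal; auto using cont_mult, cont_const, cont_psum.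
  rewrite (circint_mult_psum h (fun k t => cos_coef f k * cos (INR k * t)
    + sin_coef f k * sin (INR k * t))) by easy.
  rewrite Rmult_plus_distr_l, <- psum_scal. f_equal.
  - rewrite (cos_coef_0 h). field. lra.
  - apply psum_ext. intros k _.
    rewrite (circint_ext _ (fun t => cos_coef f k * (h t * cos (INR k * t))
                                     + sin_coef f k * (h t * sin (INR k * t)))) by (intros; ring).
    rewrite circint_plus, !circint_scal by auto with cont.
    rewrite (cos_coefE h), (sin_coefE h). field. lra.
Qed.

Lemma cont_fourier_sum f n : cont (fourier_sum f n).
Proof.
  apply cont_plus; [apply cont_const|].
  apply (cont_psum (fun k t => cos_coef f k * cos (INR k * t) + sin_coef f k * sin (INR k * t))).
  auto with cont.
Qed.

(** Does the work of Parseval where only a sign is wanted. Against a partial sum of [f] the integral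
    is a finite sum of nonnegative terms, and the uniform [1/n] error of that partial sum bounds the
    integral below by a quantity tending to 0. *)
Lemma circint_mult_ge0 h f : cont h -> smooth f -> periodic f ->
  (forall n, 0 <= cos_coef h n * cos_coef f n) ->
  (forall n, 0 <= sin_coef h n * sin_coef f n) ->
  0 <= circint (fun t => h t * f t).
Proof.
  intros Ch Hf Pf Hc Hs. generalize PI_RGT_0; intros Hpi.
  set (M := circint (fun t => Rabs (Derive (Derive f) t)) / PI).
  set (A := circint (fun t => Rabs (h t))).
  assert (HA : 0 <= A) by (apply circint_ge0; auto with cont; intros; apply Rabs_pos).
  assert (HM : 0 <= M).
  { apply Rmult_le_pos; [|now apply Rlt_le, Rinv_0_lt_compat].
    apply circint_ge0; auto with cont. intros; apply Rabs_pos. }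
  assert (H : forall n, - (M * A) / INR (S n) <= circint (fun t => h t * f t)).
  { intros n.
    rewrite (circint_ext _ (fun t => h t * fourier_sum f (S n) t
      + h t * (f t - fourier_sum f (S n) t))) by (intros; ring).
    generalize (cont_fourier_sum f (S n)); intros CS.
    rewrite circint_plus by auto with cont.
    assert (H1 : 0 <= circint (fun t => h t * fourier_sum f (S n) t)).
    { rewrite circint_mult_fourier_sum by easy. apply Rmult_le_pos; [lra|].
      apply Rplus_le_le_0_compat; [generalize (Hc 0%nat); lra|].
      apply psum_ge0. intros k. generalize (Hc k) (Hs k); lra. }
    assert (H2 : Rabs (circint (fun t => h t * (f t - fourier_sum f (S n) t)))
                 <= circint (fun t => M / INR (S n) * Rabs (h t))).
    { apply circint_abs_le; auto with cont. intros t Ht.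
      rewrite Rabs_mult, Rmult_comm. apply Rmult_le_compat_r; [apply Rabs_pos|].
      now apply fourier_sum_close. }
    rewrite circint_scal in H2 by auto with cont. fold A in H2.
    apply Rabs_le_between in H2. unfold Rdiv in *. lra. }
  apply Rnot_lt_le. intros Hneg.
  set (I := circint (fun t => h t * f t)) in *.
  destruct (INR_unbounded (M * A / - I)) as [n Hn].
  assert (Hn' : M * A / - I < INR (S n)) by (rewrite S_INR; lra).
  assert (Hp : 0 < INR (S n)) by (apply lt_0_INR; lia).
  specialize (H n).
  apply (Rmult_lt_compat_r (- I)) in Hn'; [|lra].
  apply (Rmult_le_compat_r (INR (S n))) in H; [|lra].
  replace (M * A / - I * - I) with (M * A) in Hn' by (field; lra).
  replace (- (M * A) / INR (S n) * INR (S n)) with (- (M * A)) in H by (field; lra).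
  lra.
Qed.

(** * Hill's equation with periodic solutions *)

Lemma cos_coef_oscillator f m n : smooth f -> periodic f ->
  cos_coef (fun t => Derive (Derive f) t + m * f t) n = (m - INR n ^ 2) * cos_coef f n.
Proof.
  intros Hf Pf.
  transitivity (cos_coef (Derive (Derive f)) n + m * cos_coef f n).
  - rewrite !cos_coefE.
    rewrite (circint_ext _ (fun t => Derive (Derive f) t * cos (INR n * t)
                                     + m * (f t * cos (INR n * t)))) by (intros; ring).
    rewrite circint_plus, circint_scal by auto 7 with cont.
    generalize PI_RGT_0; intros; field; lra.
  - rewrite cos_coef_Derive, sin_coef_Derive by auto using smooth_Derive, periodic_Derive. ring.
Qed.

Lemma sin_coef_oscillator f m n : smooth f -> periodic f ->
  sin_coef (fun t => Derive (Derive f) t + m * f t) n = (m - INR n ^ 2) * sin_coef f n.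
Proof.
  intros Hf Pf.
  transitivity (sin_coef (Derive (Derive f)) n + m * sin_coef f n).
  - rewrite !sin_coefE.
    rewrite (circint_ext _ (fun t => Derive (Derive f) t * sin (INR n * t)
                                     + m * (f t * sin (INR n * t)))) by (intros; ring).
    rewrite circint_plus, circint_scal by auto 7 with cont.
    generalize PI_RGT_0; intros; field; lra.
  - rewrite sin_coef_Derive, cos_coef_Derive by auto using smooth_Derive, periodic_Derive. ring.
Qed.

Lemma oscillators_ge0 f m m' : smooth f -> periodic f ->
  (forall n : nat, 0 <= (m - INR n ^ 2) * (m' - INR n ^ 2)) ->
  0 <= circint (fun t => (Derive (Derive f) t + m * f t) * (Derive (Derive f) t + m' * f t)).
Proof.
  intros Hf Pf H.
  apply (circint_mult_ge0 (fun t => Derive (Derive f) t + m * f t)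
           (fun t => Derive (Derive f) t + m' * f t)).
  - auto 7 with cont.
  - auto 7 with cont.
  - intros t. now rewrite !periodic_Derive, Pf by auto using periodic_Derive.
  - intros n. rewrite !cos_coef_oscillator by easy.
    replace (_ * _) with ((m - INR n ^ 2) * (m' - INR n ^ 2) * cos_coef f n ^ 2) by ring.
    apply Rmult_le_pos; [apply H|apply pow2_ge_0].
  - intros n. rewrite !sin_coef_oscillator by easy.
    replace (_ * _) with ((m - INR n ^ 2) * (m' - INR n ^ 2) * sin_coef f n ^ 2) by ring.
    apply Rmult_le_pos; [apply H|apply pow2_ge_0].
Qed.

(** With [r = f'' + 4 f] one has [f'' + f = r - 3 f]. The symbol of the product is nonnegative
    because no square lies strictly between 1 and 4. *)
Lemma oscillator_upper f : smooth f -> periodic f ->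
  3 * circint (fun t => (Derive (Derive f) t + 4 * f t) * f t)
  <= circint (fun t => (Derive (Derive f) t + 4 * f t) ^ 2).
Proof.
  intros Hf Pf.
  assert (H := oscillators_ge0 f 4 1 Hf Pf).
  rewrite (circint_ext _ (fun t => (Derive (Derive f) t + 4 * f t) ^ 2
    + -3 * ((Derive (Derive f) t + 4 * f t) * f t))) in H by (intros; ring).
  rewrite circint_plus, circint_scal in H by auto 9 with cont.
  enough (0 <= circint (fun t => (Derive (Derive f) t + 4 * f t) ^ 2)
     + -3 * circint (fun t => (Derive (Derive f) t + 4 * f t) * f t)) by lra.
  apply H. intros [|[|n]]; [simpl; lra|simpl; lra|].
  assert (2 <= INR (S (S n))) by (apply (le_INR 2); lia).
  assert (4 <= INR (S (S n)) ^ 2) by nra. nra.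
Qed.

(** Here [f'' + 9 f = r + 5 f] with [r = f'' + 4 f], and no square lies strictly between 4 and 9. *)
Lemma oscillator_lower f : smooth f -> periodic f ->
  - circint (fun t => (Derive (Derive f) t + 4 * f t) ^ 2)
  <= 5 * circint (fun t => (Derive (Derive f) t + 4 * f t) * f t).
Proof.
  intros Hf Pf.
  assert (H := oscillators_ge0 f 4 9 Hf Pf).
  rewrite (circint_ext _ (fun t => (Derive (Derive f) t + 4 * f t) ^ 2
    + 5 * ((Derive (Derive f) t + 4 * f t) * f t))) in H by (intros; ring).
  rewrite circint_plus, circint_scal in H by auto 9 with cont.
  enough (0 <= circint (fun t => (Derive (Derive f) t + 4 * f t) ^ 2)
     + 5 * circint (fun t => (Derive (Derive f) t + 4 * f t) * f t)) by lra.
  apply H. intros [|[|[|n]]]; [simpl; lra|simpl; lra|simpl; lra|].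
  assert (3 <= INR (S (S (S n)))) by (rewrite !S_INR; generalize (pos_INR n); lra).
  assert (9 <= INR (S (S (S n))) ^ 2) by nra. nra.
Qed.

(** Gronwall for the energy [u^2 + u'^2], where [c] will be [cos] or [sin] and [u] the deviation of
    a coordinate from it. The weight [exp (- 2 s)] absorbs everything but [q^2], and undoing it over
    a period costs [exp (4 PI)]. Bounding by the integral of [q^2], not by its supremum, is what
    makes later errors comparable to that integral. *)
Lemma forced_oscillator_bound q c u : cont q -> cont c -> smooth u ->
  (forall t, Rabs (q t) <= 1) -> (forall t, Rabs (c t) <= 1) ->
  (forall t, Derive (Derive u) t + u t = - q t * (c t + u t)) ->
  u 0 = 0 -> Derive u 0 = 0 ->
  forall t, 0 < t < 2 * PI ->
    u t ^ 2 + Derive u t ^ 2 <= exp (4 * PI) * circint (fun s => q s ^ 2).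
Proof.
  intros Cq Cc Hu Bq Bc Hode H0 H1 t Ht.
  set (F := fun s => exp (- 2 * s) * (u s ^ 2 + Derive u s ^ 2)).
  set (dF := fun s => exp (- 2 * s) *
     (- 2 * (u s ^ 2 + Derive u s ^ 2) - 2 * Derive u s * q s * (c s + u s))).
  assert (Cexp : cont (fun s => exp (- 2 * s))).
  { intros s. apply (ex_derive_continuous (V := R_NormedModule)). auto_derive; easy. }
  assert (CdF : cont dF) by (unfold dF; auto 15 with cont).
  assert (HF : forall s, is_derive F s (dF s)).
  { intros s. unfold F, dF. auto_derive.
    - repeat split; apply smooth_ex_derive; auto with cont.
    - change (Derive (fun x => u x) s) with (Derive u s).
      change (Derive (fun x => Derive u x) s) with (Derive (Derive u) s).
      assert (Hs := Hode s).
      replace (Derive (Derive u) s) with (- q s * (c s + u s) - u s) by lra. ring. }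
  assert (HR : is_RInt dF 0 t (F t)).
  { replace (F t) with (minus (F t) (F 0)).
    - apply (is_RInt_derive (V := R_CompleteNormedModule)); intros; [apply HF|apply CdF].
    - unfold minus, plus, opp; simpl. unfold F. rewrite H0, H1. ring. }
  apply (is_RInt_unique (V := R_CompleteNormedModule)) in HR.
  assert (Hle : RInt dF 0 t <= RInt (fun s => q s ^ 2) 0 t).
  { apply RInt_le; [lra|apply cont_ex_RInt; auto with cont..|].
    intros s Hs. unfold dF.
    assert (He : 0 < exp (- 2 * s) <= 1).
    { split; [apply exp_pos|]. rewrite <- exp_0. apply Rlt_le, exp_increasing. lra. }
    (* By completing squares, [- 2 u' q c <= q^2 c^2 + u'^2] and [- 2 u' q u <= q^2 u^2 + u'^2];
       then [c^2 <= 1] and [q^2 <= 1]. *)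
    assert (Hin : - 2 * (u s ^ 2 + Derive u s ^ 2) - 2 * Derive u s * q s * (c s + u s) <= q s ^ 2).
    { assert (Hc : c s ^ 2 <= 1).
      { rewrite <- (pow2_abs (c s)). generalize (Bc s) (Rabs_pos (c s)); nra. }
      assert (Hq : q s ^ 2 <= 1).
      { rewrite <- (pow2_abs (q s)). generalize (Bq s) (Rabs_pos (q s)); nra. }
      generalize (pow2_ge_0 (q s * c s + Derive u s)) (pow2_ge_0 (q s * u s + Derive u s)).
      generalize (pow2_ge_0 (q s)) (pow2_ge_0 (u s)).
      nra. }
    generalize (pow2_ge_0 (q s)). nra. }
  assert (HC : RInt (fun s => q s ^ 2) 0 t <= circint (fun s => q s ^ 2)).
  { unfold circint. rewrite <- (RInt_Chasles (fun s => q s ^ 2) 0 t (2 * PI))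
      by (apply cont_ex_RInt; auto with cont).
    unfold plus; simpl.
    assert (0 <= RInt (fun s => q s * (q s * 1)) t (2 * PI)).
    { apply RInt_ge_0; [lra|apply (cont_ex_RInt (fun s => q s ^ 2)); auto with cont|].
      intros s _. exact (pow2_ge_0 (q s)). }
    lra. }
  assert (HE : u t ^ 2 + Derive u t ^ 2 = exp (2 * t) * F t).
  { unfold F. rewrite <- Rmult_assoc, <- exp_plus.
    replace (2 * t + - 2 * t) with 0 by ring. rewrite exp_0; ring. }
  rewrite HE. rewrite HR in Hle.
  assert (HJ : 0 <= circint (fun s => q s ^ 2)).
  { apply circint_ge0; auto with cont. intros; apply pow2_ge_0. }
  apply Rle_trans with (exp (2 * t) * circint (fun s => q s ^ 2)).
  - apply Rmult_le_compat_l; [apply Rlt_le, exp_pos|lra].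
  - apply Rmult_le_compat_r; [easy|]. apply Rlt_le, exp_increasing. lra.
Qed.

(** * Displacement from the circle in the moving frame *)

Definition normalized_hill_pair (q X Y : R -> R) : Prop :=
  smooth X /\ smooth Y /\ periodic X /\ periodic Y /\
  (forall t, Derive (Derive X) t = - (1 + q t) * X t) /\
  (forall t, Derive (Derive Y) t = - (1 + q t) * Y t) /\
  (X 0 = 1 /\ Derive X 0 = 0 /\ Y 0 = 0 /\ Derive Y 0 = 1) /\
  (forall t, X t * Derive Y t - Y t * Derive X t = 1).

Definition radial (X Y : R -> R) (t : R) : R := X t * cos t + Y t * sin t.
Definition angular (X Y : R -> R) (t : R) : R := Y t * cos t - X t * sin t.

Lemma smooth_radial X Y : smooth X -> smooth Y -> smooth (radial X Y).
Proof. intros; unfold radial; auto with cont. Qed.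

Lemma smooth_angular X Y : smooth X -> smooth Y -> smooth (angular X Y).
Proof. intros; unfold angular; auto with cont. Qed.

Lemma periodic_radial X Y : periodic X -> periodic Y -> periodic (radial X Y).
Proof. intros HX HY t; unfold radial. now rewrite HX, HY, periodic_cos1, periodic_sin1. Qed.

Lemma periodic_angular X Y : periodic X -> periodic Y -> periodic (angular X Y).
Proof. intros HX HY t; unfold angular. now rewrite HX, HY, periodic_cos1, periodic_sin1. Qed.

Lemma Derive_radial X Y t : smooth X -> smooth Y ->
  Derive (radial X Y) t = radial (Derive X) (Derive Y) t + angular X Y t.
Proof.
  intros HX HY. apply is_derive_unique. unfold radial, angular. auto_derive.
  - repeat split; now apply smooth_ex_derive.
  - change (Derive (fun x => X x)) with (Derive X). change (Derive (fun x => Y x)) with (Derive Y). ring.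
Qed.

Lemma Derive_angular X Y t : smooth X -> smooth Y ->
  Derive (angular X Y) t = angular (Derive X) (Derive Y) t - radial X Y t.
Proof.
  intros HX HY. apply is_derive_unique. unfold radial, angular. auto_derive.
  - repeat split; now apply smooth_ex_derive.
  - change (Derive (fun x => X x)) with (Derive X). change (Derive (fun x => Y x)) with (Derive Y). ring.
Qed.

Lemma cos2_sin2 t : cos t ^ 2 + sin t ^ 2 = 1.
Proof. rewrite <- !Rsqr_pow2, Rplus_comm. apply sin2_cos2. Qed.

(* In the moving frame of the circle, [N] and [T] are the components of the displacement, and
   [A], [b] those of the displacement of the derivative. *)
Lemma hill_pair_displacement q X Y t : normalized_hill_pair q X Y -> cont q ->
  (forall s, Rabs (q s) <= 1) -> 0 < t < 2 * PI ->
  let N := radial X Y t - 1 in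
  let T := angular X Y t in
  let A := radial (Derive X) (Derive Y) t in
  let b := angular (Derive X) (Derive Y) t - 1 in
  N ^ 2 + T ^ 2 + A ^ 2 + b ^ 2 <= 2 * (exp (4 * PI) * circint (fun s => q s ^ 2)).
Proof.
  intros (HX & HY & PX & PY & EX & EY & (X0 & X1 & Y0 & Y1) & W) Cq Bq Ht. cbv zeta.
  assert (Hx : forall s, Derive (fun u => X u - cos u) s = Derive X s + sin s).
  { intros s. apply is_derive_unique. auto_derive; [now apply smooth_ex_derive|].
    change (Derive (fun x => X x)) with (Derive X). ring. }
  assert (Hy : forall s, Derive (fun u => Y u - sin u) s = Derive Y s - cos s).
  { intros s. apply is_derive_unique. auto_derive; [now apply smooth_ex_derive|].
    change (Derive (fun x => Y x)) with (Derive Y). ring. }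
  assert (B1 := forced_oscillator_bound q cos (fun u => X u - cos u)).
  assert (B2 := forced_oscillator_bound q sin (fun u => Y u - sin u)).
  specialize (B1 Cq ltac:(auto with cont) ltac:(auto with cont) Bq).
  specialize (B2 Cq ltac:(auto with cont) ltac:(auto with cont) Bq).
  assert (H1 : (X t - cos t) ^ 2 + (Derive X t + sin t) ^ 2 <= exp (4 * PI) * circint (fun s => q s ^ 2)).
  { rewrite <- Hx. apply B1; trivial.
    - intros s. apply Rabs_le, COS_bound.
    - intros s. rewrite (Derive_ext _ _ _ Hx).
      replace (Derive (fun u => Derive X u + sin u) s) with (Derive (Derive X) s + cos s).
      + rewrite EX. ring.
      + symmetry. apply is_derive_unique. auto_derive; [apply smooth_ex_derive; auto with cont|].
        change (Derive (fun x => Derive X x)) with (Derive (Derive X)). ring.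
    - rewrite X0, cos_0; ring.
    - rewrite Hx, X1, sin_0; ring. }
  assert (H2 : (Y t - sin t) ^ 2 + (Derive Y t - cos t) ^ 2 <= exp (4 * PI) * circint (fun s => q s ^ 2)).
  { rewrite <- Hy. apply B2; trivial.
    - intros s. apply Rabs_le, SIN_bound.
    - intros s. rewrite (Derive_ext _ _ _ Hy).
      replace (Derive (fun u => Derive Y u - cos u) s) with (Derive (Derive Y) s + sin s).
      + rewrite EY. ring.
      + symmetry. apply is_derive_unique. auto_derive; [apply smooth_ex_derive; auto with cont|].
        change (Derive (fun x => Derive Y x)) with (Derive (Derive Y)). ring.
    - rewrite Y0, sin_0; ring.
    - rewrite Hy, Y1, cos_0; ring. }
  assert (Hc := cos2_sin2 t). unfold radial, angular.
  (* The moving frame is orthonormal, so both sides are the same squared norm; they differ by a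
     multiple of [cos^2 + sin^2 - 1]. *)
  replace ((X t * cos t + Y t * sin t - 1) ^ 2 + (Y t * cos t - X t * sin t) ^ 2 +
    (Derive X t * cos t + Derive Y t * sin t) ^ 2 +
    (Derive Y t * cos t - Derive X t * sin t - 1) ^ 2)
   with ((X t - cos t) ^ 2 + (Derive X t + sin t) ^ 2 + ((Y t - sin t) ^ 2 + (Derive Y t - cos t) ^ 2)
     + ((X t ^ 2 + Y t ^ 2) + (Derive X t ^ 2 + Derive Y t ^ 2) - 2) * (cos t ^ 2 + sin t ^ 2 - 1))
   by ring.
  rewrite Hc. lra.
Qed.

(** Write [J] for the integral of [q^2]. The displacements are of order [sqrt J], and the nonlinear
    remainder [e] is quadratic in them and [q]. As [J] is itself of order [delta^2], one gets [e^2]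
    of order [delta^2 J], which leaves an error [delta J], negligible against [J]. *)
Lemma hill_mean_bounds : exists M, 0 < M /\ forall q X Y delta,
  0 < delta <= 1 -> cont q -> (forall t, Rabs (q t) <= delta) ->
  normalized_hill_pair q X Y ->
  - (1 / 5 + M * delta) * circint (fun t => q t ^ 2) <= circint q
  <= (1 / 3 + M * delta) * circint (fun t => q t ^ 2).
Proof.
  (* [K] is the Gronwall constant. [L] is such that [K J <= L delta^2], as [J <= 2 PI delta^2]. *)
  set (K := exp (4 * PI)). set (L := 2 * PI * K).
  assert (Hpi := PI_RGT_0). assert (HK : 0 < K) by apply exp_pos.
  assert (HLe : L = 2 * PI * K) by reflexivity. clearbody L.
  assert (HL : 0 < L) by nra.
  (* The first two terms pay for replacing the integral of [r^2] by [J], the last one for the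
     integral of [e N]. *)
  exists (1 + 2 * L * (8 * L + 4) + L * (4 * L + 3)). split; [nra|].
  intros q X Y delta Hd Cq Bq Hp.
  assert (Hp' := Hp).
  destruct Hp' as (HX & HY & PX & PY & EX & EY & _ & W).
  set (J := circint (fun t => q t ^ 2)).
  assert (HJ0 : 0 <= J) by (apply circint_ge0; auto with cont; intros; apply pow2_ge_0).
  assert (Bq2 : forall t, q t ^ 2 <= delta ^ 2).
  { intros t. rewrite <- (pow2_abs (q t)). generalize (Bq t) (Rabs_pos (q t)); nra. }
  assert (HJ : J <= 2 * PI * delta ^ 2).
  { rewrite <- circint_const. apply circint_le; auto with cont. }
  set (N := fun t => radial X Y t - 1).
  set (T := angular X Y).
  set (A := radial (Derive X) (Derive Y)).
  set (b := fun t => angular (Derive X) (Derive Y) t - 1).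
  assert (SN : smooth N) by (unfold N; auto using smooth_minus, smooth_radial, smooth_const).
  assert (ST : smooth T) by (apply smooth_angular; trivial).
  assert (SA : smooth A) by (apply smooth_radial; auto with cont).
  assert (Sb : smooth b)
    by (unfold b; apply smooth_minus; [apply smooth_angular; auto with cont|apply smooth_const]).
  assert (PN : periodic N) by (intros t; unfold N; now rewrite periodic_radial).
  assert (PT : periodic T) by (apply periodic_angular; trivial).
  assert (DN : forall t, Derive N t = A t + T t).
  { intros t. unfold N, A, T. rewrite Derive_minus, Derive_const, Derive_radial; trivial; [ring| |].
    - apply smooth_ex_derive, smooth_radial; trivial.
    - apply ex_derive_const. }
  assert (DT : forall t, Derive T t = b t - N t).
  { intros t. unfold N, b, T. rewrite Derive_angular by trivial. ring. }
  assert (DDN : forall t, Derive (Derive N) t = 2 * Derive T t - q t * (1 + N t)).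
  { intros t. rewrite (Derive_ext _ _ _ DN), Derive_plus by (apply smooth_ex_derive; trivial).
    unfold A at 1. rewrite Derive_radial, DT by auto with cont.
    unfold N, b, radial, angular. rewrite EX, EY. ring. }
  (* The equation for [N''] gives [N'' + 4 N = 2 (N + b) - q - q N]. The Wronskian condition reads
     [(1 + N) (1 + b) - T A = 1], so the apparently linear term [N + b] equals the quadratic
     [T A - N b]. Hence [r = e - q] with [e] of second order. *)
  set (e := fun t => 2 * (T t * A t - N t * b t) - q t * N t).
  set (r := fun t => Derive (Derive N) t + 4 * N t).
  assert (Ce : cont e) by (unfold e; auto 10 with cont).
  assert (Cr : cont r) by (unfold r; auto 10 with cont).
  assert (Hr : forall t, r t = e t - q t).
  { intros t. unfold r, e. rewrite DDN, DT.
    assert (HW : N t + b t + N t * b t - T t * A t = 0).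
    { unfold N, b, T, A, radial, angular. assert (Hc := cos2_sin2 t). assert (HWt := W t).
      replace (_ - _) with ((X t * Derive Y t - Y t * Derive X t) * (cos t ^ 2 + sin t ^ 2) - 1) by ring.
      rewrite Hc, HWt. ring. }
    lra. }
  assert (Hm : forall t, 0 < t < 2 * PI -> N t ^ 2 + T t ^ 2 + A t ^ 2 + b t ^ 2 <= 2 * (K * J)).
  { intros t Ht. apply (hill_pair_displacement q X Y t); trivial.
    intros s. apply Rle_trans with (1 := Bq s). lra. }
  assert (HKJ : 0 <= K * J <= L * delta ^ 2) by nra.
  (* Since [e = 2 w - q N], [e^2 <= 8 w^2 + 2 (q N)^2] with [w^2 <= (K J)^2] and [N^2 <= 2 K J];
     this produces [8 L + 4]. *)
  assert (He2 : forall t, 0 < t < 2 * PI -> e t ^ 2 <= K * J * delta ^ 2 * (8 * L + 4)).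
  { intros t Ht. assert (H := Hm t Ht). unfold e.
    set (w := T t * A t - N t * b t).
    assert (Hw : Rabs w <= K * J).
    { apply Rabs_le. unfold w.
      generalize (pow2_ge_0 (T t + A t)) (pow2_ge_0 (T t - A t)) (pow2_ge_0 (N t + b t))
        (pow2_ge_0 (N t - b t)). nra. }
    assert (Hw2 : w ^ 2 <= (K * J) ^ 2).
    { rewrite <- (pow2_abs w). apply pow_incr. split; [apply Rabs_pos|easy]. }
    assert (HN : N t ^ 2 <= 2 * (K * J)).
    { generalize (pow2_ge_0 (T t)) (pow2_ge_0 (A t)) (pow2_ge_0 (b t)); lra. }
    assert (HqN : (q t * N t) ^ 2 <= delta ^ 2 * (2 * (K * J))).
    { rewrite Rpow_mult_distr. apply Rmult_le_compat; trivial; apply pow2_ge_0. }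
    assert (HKJ2 : (K * J) ^ 2 <= K * J * (L * delta ^ 2)).
    { simpl (_ ^ 2) at 1. rewrite Rmult_1_r. apply Rmult_le_compat_l; lra. }
    generalize (pow2_ge_0 (2 * w + q t * N t)). nra. }
  assert (HN2 : forall t, 0 < t < 2 * PI -> N t ^ 2 <= 2 * (K * J)).
  { intros t Ht. assert (H := Hm t Ht).
    generalize (pow2_ge_0 (T t)) (pow2_ge_0 (A t)) (pow2_ge_0 (b t)); lra. }
  assert (HeN : Rabs (circint (fun t => e t * N t)) <= L * (4 * L + 3) * (delta * J)).
  { apply Rle_trans with (circint (fun _ => K * J * delta * (4 * L + 3))).
    - apply circint_abs_le; auto with cont. intros t Ht.
      assert (H1 := He2 t Ht). assert (H2 := HN2 t Ht).
      (* The weight [delta] balances the two squares: [e^2] and [delta^2 N^2] are both of order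
         [delta^2 J]. *)
      assert (Hab : delta * (2 * Rabs (e t * N t)) <= e t ^ 2 + delta ^ 2 * N t ^ 2).
      { rewrite Rabs_mult, <- (pow2_abs (e t)), <- (pow2_abs (N t)).
        generalize (pow2_ge_0 (Rabs (e t) - delta * Rabs (N t))). nra. }
      assert (H3 : delta * (2 * Rabs (e t * N t)) <= delta * (2 * (K * J * delta * (4 * L + 3)))).
      { assert (delta ^ 2 * N t ^ 2 <= delta ^ 2 * (2 * (K * J)))
          by (apply Rmult_le_compat_l; [apply pow2_ge_0|easy]). nra. }
      apply Rmult_le_reg_l in H3; lra.
    - rewrite circint_const. right; rewrite HLe; ring. }
  assert (Ie2 : circint (fun t => e t ^ 2) <= L * J * delta ^ 2 * (8 * L + 4)).
  { apply Rle_trans with (circint (fun _ => K * J * delta ^ 2 * (8 * L + 4))).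
    - apply circint_le; auto with cont.
    - rewrite circint_const. right; rewrite HLe; ring. }
  assert (Ir2 : circint (fun t => r t ^ 2) <= J + (1 + 2 * L * (8 * L + 4)) * (delta * J)).
  (* Young's inequality for [(e - q)^2]. The factor [/ delta] is harmless, since the integral of
     [e^2] carries [delta ^ 2]. *)
  { apply Rle_trans with (circint (fun t => (1 + delta) * q t ^ 2 + (1 + / delta) * e t ^ 2)).
    - apply circint_le; auto with cont. intros t _. rewrite Hr.
      assert (Hdi : delta * / delta = 1) by (apply Rinv_r; lra).
      assert (0 < / delta) by (apply Rinv_0_lt_compat; lra).
      assert (Hsq := pow2_ge_0 (delta * q t + e t)).
      assert (Hx : 0 <= / delta * (delta * q t + e t) ^ 2) by (apply Rmult_le_pos; lra).
      replace (/ delta * (delta * q t + e t) ^ 2) with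
        (delta * / delta * (delta * q t ^ 2 + 2 * q t * e t) + / delta * e t ^ 2) in Hx by ring.
      rewrite Hdi in Hx. nra.
    - rewrite circint_plus, !circint_scal by auto with cont. fold J.
      assert (0 < / delta) by (apply Rinv_0_lt_compat; lra).
      apply Rle_trans with ((1 + delta) * J + (1 + / delta) * (L * J * delta ^ 2 * (8 * L + 4))).
      + apply Rplus_le_compat_l, Rmult_le_compat_l; lra.
      + replace ((1 + / delta) * (L * J * delta ^ 2 * (8 * L + 4)))
          with ((L * J * delta * (8 * L + 4)) * (delta + 1)) by (field; lra).
        assert (0 <= L * J * delta * (8 * L + 4)).
        { repeat (apply Rmult_le_pos; try lra). }
        nra. }
  (* The equation for [N''] expresses [q (1 + N)] as a derivative of a periodic function, so its
     integral vanishes. Substituting [q = e - r] in the product [q N] gives the identity. *)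
  assert (Hq : circint q = circint (fun t => r t * N t) - circint (fun t => e t * N t)).
  { assert (H0 : circint (fun t => q t * (1 + N t)) = 0).
    { rewrite (circint_ext _ (fun t => 2 * Derive T t + -1 * Derive (Derive N) t))
        by (intros t; rewrite DDN; ring).
      rewrite circint_plus, !circint_scal, !circint_Derive; auto with cont; [ring|].
      now apply periodic_Derive. }
    rewrite (circint_ext _ (fun t => q t + (e t * N t + -1 * (r t * N t)))) in H0
      by (intros t; rewrite Hr; ring).
    rewrite !circint_plus, circint_scal in H0 by auto 8 with cont. lra. }
  assert (U := oscillator_upper N SN PN). assert (Lo := oscillator_lower N SN PN).
  fold r in U, Lo.
  change (fun t => (Derive (Derive N) t + 4 * N t) * N t) with (fun t => r t * N t) in U, Lo.
  change (fun t => (Derive (Derive N) t + 4 * N t) ^ 2) with (fun t => r t ^ 2) in U, Lo.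
  apply Rabs_le_between in HeN.
  assert (0 <= delta * J) by nra.
  assert (0 <= 2 * L * (8 * L + 4) * (delta * J)) by (repeat (apply Rmult_le_pos; try lra)).
  split; lra.
Qed.

(** * Local extrema *)

Lemma is_derive_Rpower_1plus a x : -1 < x ->
  is_derive (fun y => Rpower (1 + y) a) x (a * Rpower (1 + x) (a - 1)).
Proof.
  intros Hx. unfold Rpower. auto_derive; [lra|].
  replace (a * ln (1 + x)) with ((a - 1) * ln (1 + x) + ln (1 + x)) by ring.
  rewrite exp_plus, exp_ln by lra. field. lra.
Qed.

Lemma Rpower_one a : Rpower 1 a = 1.
Proof. unfold Rpower. now rewrite ln_1, Rmult_0_r, exp_0. Qed.

(** The derivative of the remainder is [a] times the first-order remainder of [(1 + y) ^ (a - 1)],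
    which is [o(y)] by differentiability at 0 alone; the mean value theorem then yields [o(x^2)]. *)
Lemma Rpower_taylor2 a kappa : 0 < kappa -> exists eta, 0 < eta < 1 /\
  forall x, Rabs x <= eta ->
    Rabs (Rpower (1 + x) a - 1 - a * x - a * (a - 1) / 2 * x ^ 2) <= kappa * x ^ 2.
Proof.
  intros Hk. assert (Ha := Rabs_pos a).
  set (k' := kappa / (Rabs a + 1)).
  assert (Hk' : 0 < k') by (apply Rdiv_lt_0_compat; lra).
  assert (Hd : derivable_pt_lim (fun y => Rpower (1 + y) (a - 1)) 0 (a - 1)).
  { apply is_derive_Reals.
    generalize (is_derive_Rpower_1plus (a - 1) 0 ltac:(lra)).
    now rewrite Rplus_0_r, Rpower_one, Rmult_1_r. }
  destruct (Hd k' Hk') as [d Hd']. assert (Hdp := cond_pos d).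
  exists (Rmin (d / 2) (/ 2)).
  assert (He : 0 < Rmin (d / 2) (/ 2) <= / 2 /\ Rmin (d / 2) (/ 2) < d).
  { unfold Rmin. destruct (Rle_dec _ _); lra. }
  split; [lra|]. intros x Hx.
  assert (Hh : forall c, Rabs c <= Rabs x ->
    Rabs (Rpower (1 + c) (a - 1) - 1 - (a - 1) * c) <= k' * Rabs c).
  { intros c Hc. destruct (Req_dec c 0) as [->|Hc0].
    - rewrite Rplus_0_r, Rpower_one, Rabs_R0.
      replace (1 - 1 - (a - 1) * 0) with 0 by ring. rewrite Rabs_R0; lra.
    - specialize (Hd' c Hc0). rewrite Rplus_0_l, Rplus_0_r, Rpower_one in Hd'.
      replace (Rpower (1 + c) (a - 1) - 1 - (a - 1) * c)
        with (((Rpower (1 + c) (a - 1) - 1) / c - (a - 1)) * c) by (field; easy).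
      rewrite Rabs_mult. apply Rmult_le_compat_r; [apply Rabs_pos|]. apply Rlt_le, Hd'; lra. }
  set (F := fun y => Rpower (1 + y) a - 1 - a * y - a * (a - 1) / 2 * y ^ 2).
  assert (HF : forall y, -1 < y -> is_derive F y (a * (Rpower (1 + y) (a - 1) - 1 - (a - 1) * y))).
  { intros y Hy. unfold F, Rpower. auto_derive; [lra|].
    replace (a * ln (1 + y)) with ((a - 1) * ln (1 + y) + ln (1 + y)) by ring.
    rewrite exp_plus, exp_ln by lra. field. lra. }
  assert (Hbd : forall y, Rmin 0 x <= y <= Rmax 0 x -> Rabs y <= Rabs x).
  { intros y. unfold Rmin, Rmax. destruct (Rle_dec 0 x); intros Hy.
    - rewrite !Rabs_pos_eq; lra.
    - rewrite !Rabs_left1; lra. }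
  destruct (MVT_gen F 0 x (fun y => a * (Rpower (1 + y) (a - 1) - 1 - (a - 1) * y))) as (c & Hc & HM).
  - intros y Hy. apply HF. assert (Rabs y <= Rabs x) by (apply Hbd; lra).
    assert (Hy1 : Rabs y <= / 2) by lra. apply Rabs_le_between in Hy1. lra.
  - intros y Hy. apply continuity_pt_filterlim.
    apply (ex_derive_continuous (V := R_NormedModule)).
    eexists. apply HF. assert (Rabs y <= Rabs x) by (apply Hbd; lra).
    assert (Hy1 : Rabs y <= / 2) by lra. apply Rabs_le_between in Hy1. lra.
  - assert (F0 : F 0 = 0) by (unfold F; rewrite Rplus_0_r, Rpower_one; ring).
    rewrite F0, !Rminus_0_r in HM. fold (F x). rewrite HM, !Rabs_mult.
    assert (Hc' := Hbd c Hc). assert (H := Hh c Hc').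
    rewrite <- (pow2_abs x). assert (Hx0 := Rabs_pos x). assert (Hc0 := Rabs_pos c).
    assert (Hka : Rabs a * k' <= kappa).
    { unfold k'. apply (Rmult_le_reg_r (Rabs a + 1)); [lra|].
      replace (Rabs a * (kappa / (Rabs a + 1)) * (Rabs a + 1)) with (Rabs a * kappa) by (field; lra).
      nra. }
    apply Rle_trans with (Rabs a * (k' * Rabs x) * Rabs x).
    + apply Rmult_le_compat_r; [easy|]. apply Rmult_le_compat_l; [easy|].
      apply Rle_trans with (1 := H). apply Rmult_le_compat_l; lra.
    + replace (Rabs a * (k' * Rabs x) * Rabs x) with ((Rabs a * k') * Rabs x ^ 2) by ring.
      apply Rmult_le_compat_r; [apply pow2_ge_0|easy].
Qed.

Lemma cont_Rpower p a : cont p -> (forall t, 0 < p t) -> cont (fun t => Rpower (p t) a).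
Proof.
  intros Cp Hp t. apply (continuous_comp p (fun y => Rpower y a)); [apply Cp|].
  apply (ex_derive_continuous (V := R_NormedModule)). unfold Rpower. auto_derive. apply Hp.
Qed.

Lemma centroaffine_curvatureE g t :
  centroaffine_curvature g t =
  Derive (fun s => fst (g s)) t * Derive (Derive (fun s => snd (g s))) t
  - Derive (fun s => snd (g s)) t * Derive (Derive (fun s => fst (g s))) t.
Proof. reflexivity. Qed.

Lemma cont_centroaffine_curvature g : smooth_curve g -> cont (centroaffine_curvature g).
Proof.
  intros [Hx Hy].
  change (cont (fun t => Derive (fun s => fst (g s)) t * Derive (Derive (fun s => snd (g s))) t
  - Derive (fun s => snd (g s)) t * Derive (Derive (fun s => fst (g s))) t)).
  auto 8 with cont.
Qed.

(* The curvature is [SL(2)]-invariant, so the curve may be moved to have the same initial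
   position and velocity as the circle. *)
Lemma curve_space_hill_pair g : curve_space g ->
  exists X Y, normalized_hill_pair (fun t => centroaffine_curvature g t - 1) X Y.
Proof.
  intros ((Hx & Hy) & Hper & Hdet & Hpos).
  set (x := fun s => fst (g s)) in *. set (y := fun s => snd (g s)) in *.
  assert (Px : periodic x) by (intros t; unfold x; now rewrite Hper).
  assert (Py : periodic y) by (intros t; unfold y; now rewrite Hper).
  assert (W : forall t, x t * Derive y t - y t * Derive x t = 1) by exact Hdet.
  assert (Ex : forall t, ex_derive x t) by (intros; now apply smooth_ex_derive).
  assert (Ey : forall t, ex_derive y t) by (intros; now apply smooth_ex_derive).
  assert (Ex' : forall t, ex_derive (Derive x) t) by (intros; apply smooth_ex_derive; auto with cont).
  assert (Ey' : forall t, ex_derive (Derive y) t) by (intros; apply smooth_ex_derive; auto with cont).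
  (* Differentiating the unit determinant shows that the second derivative is parallel to the curve;
     multiplying by the determinant, equal to 1, then identifies the factor as minus the
     curvature. *)
  assert (W' : forall t, x t * Derive (Derive y) t - y t * Derive (Derive x) t = 0).
  { intros t.
    assert (H : Derive (fun t => x t * Derive y t - y t * Derive x t) t = 0).
    { rewrite (Derive_ext _ (fun _ => 1)) by exact W. apply Derive_const. }
    rewrite Derive_minus, !Derive_mult in H; trivial; try (now apply ex_derive_mult).
    lra. }
  assert (P : forall t, centroaffine_curvature g t
    = Derive x t * Derive (Derive y) t - Derive y t * Derive (Derive x) t) by reflexivity.
  assert (EX : forall t, Derive (Derive x) t = - centroaffine_curvature g t * x t).
  { intros t. rewrite P. assert (H1 := W t). assert (H2 := W' t).
    transitivity (Derive (Derive x) t * (x t * Derive y t - y t * Derive x t)); [rewrite H1; ring|].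
    replace (y t * Derive x t) with (Derive x t * y t) by ring.
    transitivity (Derive (Derive x) t * x t * Derive y t
      - Derive x t * (x t * Derive (Derive y) t - (x t * Derive (Derive y) t - y t * Derive (Derive x) t)));
      [ring|rewrite H2; ring]. }
  assert (EY : forall t, Derive (Derive y) t = - centroaffine_curvature g t * y t).
  { intros t. rewrite P. assert (H1 := W t). assert (H2 := W' t).
    transitivity (Derive (Derive y) t * (x t * Derive y t - y t * Derive x t)); [rewrite H1; ring|].
    transitivity ((x t * Derive (Derive y) t - y t * Derive (Derive x) t) * Derive y t
      + y t * Derive (Derive x) t * Derive y t - Derive (Derive y) t * (y t * Derive x t));
      [ring|rewrite H2; ring]. }
  clear P.
  assert (DC : forall c d t, Derive (fun s => c * x s + d * y s) t = c * Derive x t + d * Derive y t).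
  { intros c d t. rewrite Derive_plus, !Derive_scal; trivial;
      apply ex_derive_mult; trivial; apply ex_derive_const. }
  assert (DC2 : forall c d t, Derive (Derive (fun s => c * x s + d * y s)) t
     = - centroaffine_curvature g t * (c * x t + d * y t)).
  { intros c d t. rewrite (Derive_ext _ _ _ (DC c d)), Derive_plus, !Derive_scal, EX, EY; [ring| |];
      apply ex_derive_mult; trivial; apply ex_derive_const. }
  (* The curve multiplied by the inverse of the matrix with columns [g(0)] and [g'(0)], whose
     determinant is 1. *)
  exists (fun t => Derive y 0 * x t + - Derive x 0 * y t), (fun t => - y 0 * x t + x 0 * y t).
  assert (W0 := W 0).
  repeat split; try (now auto with cont).
  - intros t. now rewrite Px, Py.
  - intros t. now rewrite Px, Py.
  - intros t. rewrite DC2. ring.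
  - intros t. rewrite DC2. ring.
  - lra.
  - rewrite DC. ring.
  - ring.
  - rewrite DC. lra.
  - intros t. rewrite !DC.
    transitivity ((x 0 * Derive y 0 - y 0 * Derive x 0) * (x t * Derive y t - y t * Derive x t)); [ring|].
    rewrite W0, W. ring.
Qed.

(** * The functional near the circle *)

Lemma Derive_cos_fun : Derive cos = fun t => - sin t.
Proof. apply functional_extensionality; intros t; apply is_derive_unique; auto_derive; [easy|ring]. Qed.

Lemma Derive_sin_fun : Derive sin = cos.
Proof. apply functional_extensionality; intros t; apply is_derive_unique; auto_derive; [easy|ring]. Qed.

Lemma Derive_opp_sin_fun : Derive (fun t => - sin t) = fun t => - cos t.
Proof. apply functional_extensionality; intros t; apply is_derive_unique; auto_derive; [easy|ring]. Qed.

Lemma circle_D1 t : Dcurve 1 circle t = (- sin t, cos t).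
Proof.
  change (Dcurve 1 circle t) with (Derive cos t, Derive sin t).
  now rewrite Derive_cos_fun, Derive_sin_fun.
Qed.

Lemma circle_D2 t : Dcurve 2 circle t = (- cos t, - sin t).
Proof.
  change (Dcurve 2 circle t) with (Derive (Derive cos) t, Derive (Derive sin) t).
  now rewrite Derive_sin_fun, Derive_cos_fun, Derive_opp_sin_fun.
Qed.

Lemma circle_curvature t : centroaffine_curvature circle t = 1.
Proof.
  unfold centroaffine_curvature. rewrite circle_D1, circle_D2. unfold det; simpl.
  rewrite <- (cos2_sin2 t). ring.
Qed.

Lemma calB_circle a : calB a circle = 2 * PI.
Proof.
  change (circint (fun t => Rpower (centroaffine_curvature circle t) a) = 2 * PI).
  rewrite (circint_ext _ (fun _ => 1)).
  - rewrite circint_const; ring.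
  - intros t. now rewrite circle_curvature, Rpower_one.
Qed.

Lemma curvature_close d g t : 0 < d <= 1 -> Cr_close 2 d circle g ->
  Rabs (centroaffine_curvature g t - 1) <= 6 * d.
Proof.
  intros Hd H.
  destruct (H 1%nat t ltac:(lia)) as [H1 H2]. destruct (H 2%nat t ltac:(lia)) as [H3 H4].
  rewrite circle_D1 in H1, H2. rewrite circle_D2 in H3, H4. cbn [fst snd] in *.
  unfold centroaffine_curvature, det.
  set (x1 := fst (Dcurve 1 g t)) in *. set (y1 := snd (Dcurve 1 g t)) in *.
  set (x2 := fst (Dcurve 2 g t)) in *. set (y2 := snd (Dcurve 2 g t)) in *.
  assert (Hc := cos2_sin2 t).
  (* The determinant expanded around the circle has two quadratic and four linear terms in the
     deviations. Each is at most [d], as [d <= 1]; hence the factor 6. *)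
  replace (x1 * y2 - y1 * x2 - 1) with
    ((x1 - - sin t) * (y2 - - sin t) + (- ((y1 - cos t) * (x2 - - cos t))
      + (cos t * (y1 - cos t) + (- (cos t * (x2 - - cos t))
      + (- (sin t * (y2 - - sin t)) + - (sin t * (x1 - - sin t))))))).
  2: { rewrite <- Hc. ring. }
  assert (P : forall u v B, Rabs u <= B -> Rabs v < d -> 0 <= B -> Rabs (u * v) <= B * d).
  { intros u v B Hu Hv HB. rewrite Rabs_mult. apply Rmult_le_compat; try apply Rabs_pos; lra. }
  assert (Bc : Rabs (cos t) <= 1) by apply Rabs_le, COS_bound.
  assert (Bs : Rabs (sin t) <= 1) by apply Rabs_le, SIN_bound.
  assert (B1 := P _ _ 1 (Rlt_le _ _ (Rlt_le_trans _ _ _ H1 (proj2 Hd))) H4 Rle_0_1).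
  assert (B2 := P _ _ 1 (Rlt_le _ _ (Rlt_le_trans _ _ _ H2 (proj2 Hd))) H3 Rle_0_1).
  assert (B3 := P _ _ 1 Bc H2 Rle_0_1). assert (B4 := P _ _ 1 Bc H3 Rle_0_1).
  assert (B5 := P _ _ 1 Bs H4 Rle_0_1). assert (B6 := P _ _ 1 Bs H1 Rle_0_1).
  apply Rabs_le_between in B1, B2, B3, B4, B5, B6.
  apply Rabs_le. lra.
Qed.

(** [I] and [J] stand for the integrals of [q] and [q^2]. Hiding [q] reduces each extremum to an
    inequality linear in these two numbers, with a single [kappa] for all errors. Two derivatives
    suffice for closeness, since the curvature involves no more. *)
Lemma calB_expansion a kappa : 0 < kappa -> exists d, 0 < d /\ forall g,
  curve_space g -> Cr_close 2 d circle g ->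
  exists I J, 0 <= J /\
    - (1 / 5 + kappa) * J <= I <= (1 / 3 + kappa) * J /\
    Rabs (calB a g - 2 * PI - a * I - a * (a - 1) / 2 * J) <= kappa * J.
Proof.
  intros Hk. destruct (Rpower_taylor2 a kappa Hk) as (eta & Heta & HT).
  destruct hill_mean_bounds as (M & HM & HH).
  set (delta := Rmin eta (kappa / M)).
  assert (Hkm : 0 < kappa / M) by (apply Rdiv_lt_0_compat; lra).
  assert (Hdelta : 0 < delta /\ delta <= eta /\ delta <= kappa / M).
  { unfold delta, Rmin. destruct (Rle_dec _ _); lra. }
  assert (HMd : M * delta <= kappa).
  { replace kappa with (M * (kappa / M)) by (field; lra). apply Rmult_le_compat_l; lra. }
  exists (delta / 6). split; [lra|]. intros g Hg Hclose.
  set (q := fun t => centroaffine_curvature g t - 1).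
  assert (Cp : cont (centroaffine_curvature g)) by (apply cont_centroaffine_curvature, Hg).
  assert (Cq : cont q) by (unfold q; auto with cont).
  assert (Bq : forall t, Rabs (q t) <= delta).
  { intros t. replace delta with (6 * (delta / 6)) by field. apply curvature_close; [lra|easy]. }
  exists (circint q), (circint (fun t => q t ^ 2)).
  assert (HJ : 0 <= circint (fun t => q t ^ 2)).
  { apply circint_ge0; auto with cont. intros; apply pow2_ge_0. }
  split; [easy|]. split.
  - destruct (curve_space_hill_pair g Hg) as (X & Y & HXY).
    assert (H := HH q X Y delta ltac:(lra) Cq Bq HXY). nra.
  - assert (CR : cont (fun t => Rpower (centroaffine_curvature g t) a)).
    { apply cont_Rpower; [easy|apply Hg]. }
    replace (calB a g - 2 * PI - a * circint q - a * (a - 1) / 2 * circint (fun t => q t ^ 2))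
      with (circint (fun t => Rpower (centroaffine_curvature g t) a - 1 - a * q t
                              - a * (a - 1) / 2 * q t ^ 2)).
    + rewrite <- circint_scal by auto with cont.
      apply circint_abs_le; auto 10 with cont. intros t _.
      replace (centroaffine_curvature g t) with (1 + q t) by (unfold q; ring).
      apply HT. generalize (Bq t); lra.
    + rewrite (circint_ext _ (fun t => Rpower (centroaffine_curvature g t) a
         + (-1 + (- a * q t + - (a * (a - 1) / 2) * q t ^ 2)))) by (intros; ring).
      rewrite !circint_plus, !circint_scal, circint_const by auto 10 with cont.
      change (calB a g) with (circint (fun t => Rpower (centroaffine_curvature g t) a)). ring.
Qed.

(** As [a] is negative, the upper bound on [I] is the one that bounds [a I] from below. The
    coefficient of [J] is then [c = a/3 + a (a - 1)/2], and [kappa] is chosen so that the errors add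
    up to exactly [c J]. *)
Lemma circle_local_min_neg a : a < 0 -> local_min (calB a) circle.
Proof.
  intros Ha. set (c := a * (3 * a - 1) / 6).
  assert (Hc : 0 < c) by (unfold c; nra).
  set (kappa := c / (1 - a)).
  assert (Hk : 0 < kappa) by (apply Rdiv_lt_0_compat; lra).
  assert (Hkc : kappa * (1 - a) = c) by (unfold kappa; field; lra).
  destruct (calB_expansion a kappa Hk) as (d & Hd & H).
  exists 2%nat, d. split; [easy|]. intros g Hg Hcl.
  destruct (H g Hg Hcl) as (I & J & HJ & HI & HB). rewrite calB_circle.
  apply Rabs_le_between in HB.
  assert (a * I >= a * ((1 / 3 + kappa) * J)) by nra.
  assert (Hz : (a * (1 / 3 + kappa) + a * (a - 1) / 2 - kappa) * J = 0).
  { replace (a * (1 / 3 + kappa) + a * (a - 1) / 2 - kappa) with (c - kappa * (1 - a))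
      by (unfold c; field). rewrite Hkc; ring. }
  lra.
Qed.

(** For positive [a] the upper bound on [I] bounds [a I] from above; here [c] is minus
    [a/3 + a (a - 1)/2], and [kappa] uses it up exactly. *)
Lemma circle_local_max a : 0 < a < 1 / 3 -> local_max (calB a) circle.
Proof.
  intros Ha. set (c := a * (1 - 3 * a) / 6).
  assert (Hc : 0 < c) by (unfold c; nra).
  set (kappa := c / (1 + a)).
  assert (Hk : 0 < kappa) by (apply Rdiv_lt_0_compat; lra).
  assert (Hkc : kappa * (1 + a) = c) by (unfold kappa; field; lra).
  destruct (calB_expansion a kappa Hk) as (d & Hd & H).
  exists 2%nat, d. split; [easy|]. intros g Hg Hcl.
  destruct (H g Hg Hcl) as (I & J & HJ & HI & HB). rewrite calB_circle.
  apply Rabs_le_between in HB.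
  assert (a * I <= a * ((1 / 3 + kappa) * J)) by (apply Rmult_le_compat_l; lra).
  assert (Hz : (a * (1 / 3 + kappa) + a * (a - 1) / 2 + kappa) * J = 0).
  { replace (a * (1 / 3 + kappa) + a * (a - 1) / 2 + kappa) with (kappa * (1 + a) - c)
      by (unfold c; field). rewrite Hkc; ring. }
  lra.
Qed.

(** Now the lower bound on [I] is used, with [c = - a/5 + a (a - 1)/2]; the errors again add up to
    [c J]. *)
Lemma circle_local_min_gt a : 7 / 5 < a -> local_min (calB a) circle.
Proof.
  intros Ha. set (c := a * (5 * a - 7) / 10).
  assert (Hc : 0 < c) by (unfold c; nra).
  set (kappa := c / (1 + a)).
  assert (Hk : 0 < kappa) by (apply Rdiv_lt_0_compat; lra).
  assert (Hkc : kappa * (1 + a) = c) by (unfold kappa; field; lra).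
  destruct (calB_expansion a kappa Hk) as (d & Hd & H).
  exists 2%nat, d. split; [easy|]. intros g Hg Hcl.
  destruct (H g Hg Hcl) as (I & J & HJ & HI & HB). rewrite calB_circle.
  apply Rabs_le_between in HB.
  assert (a * (- (1 / 5 + kappa) * J) <= a * I) by (apply Rmult_le_compat_l; lra).
  assert (Hz : (- a * (1 / 5 + kappa) + a * (a - 1) / 2 - kappa) * J = 0).
  { replace (- a * (1 / 5 + kappa) + a * (a - 1) / 2 - kappa) with (c - kappa * (1 + a))
      by (unfold c; field). rewrite Hkc; ring. }
  lra.
Qed.

(** * The Hessian *)

(** The curvature of a deformation is a polynomial of degree 4 in [eps]. The estimate is uniform
    over coefficients bounded by [B], so that it may be integrated in [t]. *)
Lemma Rpower_eps2 a B e : 0 < B -> 0 < e -> exists d, 0 < d /\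
  forall eps p1 p2 p3 p4, Rabs eps < d ->
    Rabs p1 <= B -> Rabs p2 <= B -> Rabs p3 <= B -> Rabs p4 <= B ->
    0 < 1 + eps * (p1 + eps * p2 + eps ^ 2 * p3 + eps ^ 3 * p4) /\
    Rabs (Rpower (1 + eps * (p1 + eps * p2 + eps ^ 2 * p3 + eps ^ 3 * p4)) a
          - 1 - eps * (a * p1) - eps ^ 2 * (a * p2 + a * (a - 1) / 2 * p1 ^ 2)) <= e * eps ^ 2.
Proof.
  intros HB He.
  (* The increment [x] satisfies [x^2 <= 16 B^2 eps^2], so the Taylor remainder takes half of the
     tolerance [e]. *)
  set (kappa := e / (32 * B ^ 2)).
  assert (HB2 : 0 < B ^ 2) by (apply pow_lt; lra).
  assert (Hk : 0 < kappa) by (apply Rdiv_lt_0_compat; lra).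
  destruct (Rpower_taylor2 a kappa Hk) as (eta & Heta & HT).
  (* Bound for what multiplies [eps ^ 3], from [|w| <= 2 B], [|v| <= 3 B] and
     [|2 p1 + eps v| <= 8 B]. It takes the other half of [e]; the added 1 keeps [C] positive. *)
  set (C := Rabs a * (2 * B) + Rabs (a * (a - 1) / 2) * (24 * B ^ 2) + 1).
  assert (Ha := Rabs_pos a). assert (Ha' := Rabs_pos (a * (a - 1) / 2)).
  assert (HC : 0 < C) by (unfold C; nra).
  exists (Rmin 1 (Rmin (eta / (4 * B)) (e / (2 * C)))).
  assert (H1 : 0 < eta / (4 * B)) by (apply Rdiv_lt_0_compat; lra).
  assert (H2 : 0 < e / (2 * C)) by (apply Rdiv_lt_0_compat; lra).
  split; [repeat apply Rmin_glb_lt; lra|].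
  intros eps p1 p2 p3 p4 Heps B1 B2 B3 B4.
  assert (He1 : Rabs eps < 1) by (eapply Rlt_le_trans; [exact Heps|apply Rmin_l]).
  assert (He2 : Rabs eps < eta / (4 * B)).
  { eapply Rlt_le_trans; [exact Heps|]. eapply Rle_trans; [apply Rmin_r|apply Rmin_l]. }
  assert (He3 : Rabs eps < e / (2 * C)).
  { eapply Rlt_le_trans; [exact Heps|]. eapply Rle_trans; [apply Rmin_r|apply Rmin_r]. }
  assert (He0 := Rabs_pos eps).
  assert (Hs : forall p b, Rabs p <= b -> Rabs (eps * p) <= b).
  { intros p b Hp. rewrite Rabs_mult. generalize (Rabs_pos p); nra. }
  set (w := p3 + eps * p4). set (v := p2 + eps * w).
  assert (Hw : Rabs w <= 2 * B).
  { eapply Rle_trans; [apply Rabs_triang|]. generalize (Hs p4 B B4). lra. }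
  assert (Hv : Rabs v <= 3 * B).
  { eapply Rle_trans; [apply Rabs_triang|]. generalize (Hs w _ Hw). lra. }
  assert (Hev := Hs v _ Hv).
  replace (p1 + eps * p2 + eps ^ 2 * p3 + eps ^ 3 * p4) with (p1 + eps * v) by (unfold v, w; ring).
  set (x := eps * (p1 + eps * v)).
  assert (HU : Rabs (p1 + eps * v) <= 4 * B).
  { eapply Rle_trans; [apply Rabs_triang|]. lra. }
  assert (Hx : Rabs x <= eta).
  { unfold x. rewrite Rabs_mult.
    replace eta with (eta / (4 * B) * (4 * B)) by (field; lra).
    apply Rmult_le_compat; try apply Rabs_pos; lra. }
  split.
  { apply Rabs_le_between in Hx. lra. }
  assert (Hx2 : x ^ 2 <= 16 * B ^ 2 * eps ^ 2).
  { unfold x. rewrite <- pow2_abs, Rabs_mult, Rpow_mult_distr, (pow2_abs eps).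
    assert (Rabs (p1 + eps * v) ^ 2 <= (4 * B) ^ 2)
      by (apply pow_incr; split; [apply Rabs_pos|easy]).
    generalize (pow2_ge_0 eps); nra. }
  assert (HTx := HT x Hx).
  match goal with |- Rabs ?X <= _ => replace X with
    ((Rpower (1 + x) a - 1 - a * x - a * (a - 1) / 2 * x ^ 2)
     + eps ^ 2 * (eps * (a * w + a * (a - 1) / 2 * (v * (2 * p1 + eps * v)))))
    by (unfold x, v; ring) end.
  assert (Hin : Rabs (a * w + a * (a - 1) / 2 * (v * (2 * p1 + eps * v))) <= C).
  { assert (H5 : Rabs (2 * p1 + eps * v) <= 8 * B).
    { eapply Rle_trans; [apply Rabs_triang|]. rewrite (Rabs_mult 2), (Rabs_pos_eq 2) by lra. lra. }
    eapply Rle_trans; [apply Rabs_triang|]. rewrite !Rabs_mult.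
    assert (Rabs v * Rabs (2 * p1 + eps * v) <= 3 * B * (8 * B))
      by (apply Rmult_le_compat; try apply Rabs_pos; easy).
    assert (Rabs a * Rabs w <= Rabs a * (2 * B)) by (apply Rmult_le_compat_l; easy).
    assert (Rabs (a * (a - 1) / 2) * (Rabs v * Rabs (2 * p1 + eps * v))
       <= Rabs (a * (a - 1) / 2) * (24 * B ^ 2)) by (apply Rmult_le_compat_l; lra).
    rewrite <- !Rabs_mult in *. unfold C. lra. }
  eapply Rle_trans; [apply Rabs_triang|].
  rewrite Rabs_mult, (Rabs_pos_eq (eps ^ 2)) by apply pow2_ge_0.
  assert (Hlast : Rabs (eps * (a * w + a * (a - 1) / 2 * (v * (2 * p1 + eps * v)))) <= e / 2).
  { rewrite Rabs_mult. replace (e / 2) with (e / (2 * C) * C) by (field; lra).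
    apply Rmult_le_compat; try apply Rabs_pos; lra. }
  assert (Hfirst : kappa * x ^ 2 <= e / 2 * eps ^ 2).
  { apply Rle_trans with (kappa * (16 * B ^ 2 * eps ^ 2)); [apply Rmult_le_compat_l; lra|].
    unfold kappa. right. field. lra. }
  assert (eps ^ 2 * Rabs (eps * (a * w + a * (a - 1) / 2 * (v * (2 * p1 + eps * v))))
     <= eps ^ 2 * (e / 2)) by (apply Rmult_le_compat_l; [apply pow2_ge_0|easy]).
  lra.
Qed.

Lemma eps2_coefficient_Rpower a (P1 P2 P3 P4 : R -> R) (b : R -> R) :
  cont P1 -> cont P2 -> cont P3 -> cont P4 ->
  periodic P1 -> periodic P2 -> periodic P3 -> periodic P4 ->
  (forall eps, b eps = circint (fun t => Rpower
     (1 + eps * (P1 t + eps * P2 t + eps ^ 2 * P3 t + eps ^ 3 * P4 t)) a)) ->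
  is_eps2_coefficient b (a * circint P2 + a * (a - 1) / 2 * circint (fun t => P1 t ^ 2)).
Proof.
  intros C1 C2 C3 C4 Q1 Q2 Q3 Q4 Hb.
  destruct (periodic_bounded P1 C1 Q1) as [B1 H1]. destruct (periodic_bounded P2 C2 Q2) as [B2 H2].
  destruct (periodic_bounded P3 C3 Q3) as [B3 H3]. destruct (periodic_bounded P4 C4 Q4) as [B4 H4].
  set (B := Rabs B1 + Rabs B2 + Rabs B3 + Rabs B4 + 1).
  assert (HB : B1 <= B - 1 /\ B2 <= B - 1 /\ B3 <= B - 1 /\ B4 <= B - 1 /\ 1 <= B).
  { unfold B. generalize (Rle_abs B1) (Rle_abs B2) (Rle_abs B3) (Rle_abs B4)
      (Rabs_pos B1) (Rabs_pos B2) (Rabs_pos B3) (Rabs_pos B4). lra. }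
  set (q := a * circint P2 + a * (a - 1) / 2 * circint (fun t => P1 t ^ 2)).
  exists (2 * PI), (a * circint P1). apply is_lim_spec. intros e.
  assert (Hpi := PI_RGT_0). assert (Hep := cond_pos e).
  (* Integrated over the period this tolerance becomes [e / 2], strictly below [e]. *)
  destruct (Rpower_eps2 a B (e / (4 * PI))) as (d & Hd & HR); [lra|apply Rdiv_lt_0_compat; lra|].
  exists (mkposreal d Hd). intros eps Hball Hne.
  assert (Heps : Rabs eps < d).
  { unfold ball in Hball; simpl in Hball; unfold AbsRing_ball, abs, minus, plus, opp in Hball;
      simpl in Hball. now rewrite Ropp_0, Rplus_0_r in Hball. }
  set (U := fun t => P1 t + eps * P2 t + eps ^ 2 * P3 t + eps ^ 3 * P4 t).
  assert (Cp : cont (fun t => 1 + eps * U t)) by (unfold U; auto 12 with cont).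
  assert (HRt : forall t, 0 < 1 + eps * U t /\
    Rabs (Rpower (1 + eps * U t) a - 1 - eps * (a * P1 t)
      - eps ^ 2 * (a * P2 t + a * (a - 1) / 2 * P1 t ^ 2)) <= e / (4 * PI) * eps ^ 2).
  { intros t. apply HR; trivial.
    - generalize (H1 t); lra.
    - generalize (H2 t); lra.
    - generalize (H3 t); lra.
    - generalize (H4 t); lra. }
  assert (CR : cont (fun t => Rpower (1 + eps * U t) a)).
  { apply (cont_Rpower (fun t => 1 + eps * U t)); [easy|apply HRt]. }
  assert (Hint : Rabs (b eps - 2 * PI - a * circint P1 * eps - q * eps ^ 2) <= e / 2 * eps ^ 2).
  { replace (b eps - 2 * PI - a * circint P1 * eps - q * eps ^ 2) with
      (circint (fun t => Rpower (1 + eps * U t) a - 1 - eps * (a * P1 t)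
      - eps ^ 2 * (a * P2 t + a * (a - 1) / 2 * P1 t ^ 2))).
    - apply Rle_trans with (circint (fun _ => e / (4 * PI) * eps ^ 2)).
      + apply circint_abs_le; auto 12 with cont. intros t _. apply HRt.
      + rewrite circint_const. right. field. lra.
    - rewrite (circint_ext _ (fun t => Rpower (1 + eps * U t) a + (-1 + ((- eps * a) * P1 t
        + ((- eps ^ 2 * a) * P2 t + (- eps ^ 2 * (a * (a - 1) / 2)) * P1 t ^ 2)))))
        by (intros; ring).
      rewrite !circint_plus, !circint_scal, circint_const by auto 12 with cont.
      rewrite Hb. unfold q. fold U.
      change (circint (fun t => Rpower (1 + eps * (P1 t + eps * P2 t + eps ^ 2 * P3 t + eps ^ 3 * P4 t)) a))
        with (circint (fun t => Rpower (1 + eps * U t) a)). ring. }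
  assert (He2 : 0 < eps ^ 2) by (now apply pow2_gt_0).
  replace ((b eps - 2 * PI - a * circint P1 * eps) / eps ^ 2 - q) with
    ((b eps - 2 * PI - a * circint P1 * eps - q * eps ^ 2) * / eps ^ 2) by (field; easy).
  rewrite Rabs_mult, (Rabs_pos_eq (/ eps ^ 2)) by (now apply Rlt_le, Rinv_0_lt_compat).
  apply Rle_lt_trans with (e / 2 * eps ^ 2 * / eps ^ 2).
  - apply Rmult_le_compat_r; [now apply Rlt_le, Rinv_0_lt_compat|easy].
  - rewrite Rmult_assoc, Rinv_r; lra.
Qed.

(** The curvature is [1 + eps P1 + eps^2 P2 + ...]; the first bracket is the integral of [P2], and
    the last integrand is the square of [P1]. *)
Definition hessian (a : R) (f : R -> R) : R :=
  a * (circint (fun t => Derive f t ^ 2) - / 4 * circint (fun t => Derive (Derive f) t ^ 2))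
  + a * (a - 1) / 2
    * circint (fun t => (Derive (Derive (Derive f)) t / 2 + 2 * Derive f t) ^ 2).

(** With [frame_y], the Cartesian coordinates of the vector [N gamma_0 + T gamma_0']. *)
Definition frame_x (N T : R -> R) (t : R) : R := N t * cos t - T t * sin t.
Definition frame_y (N T : R -> R) (t : R) : R := N t * sin t + T t * cos t.

Lemma smooth_frame N T : smooth N -> smooth T -> smooth (frame_x N T) /\ smooth (frame_y N T).
Proof. intros; unfold frame_x, frame_y; split; auto with cont. Qed.

Lemma periodic_frame N T : periodic N -> periodic T -> periodic (frame_x N T) /\ periodic (frame_y N T).
Proof.
  intros HN HT; unfold frame_x, frame_y; split; intros t;
    now rewrite HN, HT, periodic_cos1, periodic_sin1.
Qed.

(** The frame turns with [t], since [gamma_0'' = - gamma_0]. Giving the new components through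
    equations lets them be supplied in simplified form. *)
Lemma Derive_frame N T A B : smooth N -> smooth T ->
  (forall t, A t = Derive N t - T t) -> (forall t, B t = N t + Derive T t) ->
  Derive (frame_x N T) = frame_x A B /\ Derive (frame_y N T) = frame_y A B.
Proof.
  intros HN HT HA HB; split; apply functional_extensionality; intros t;
    apply is_derive_unique; unfold frame_x, frame_y; auto_derive;
    try (repeat split; now apply smooth_ex_derive);
    rewrite HA, HB; change (Derive (fun x => N x)) with (Derive N);
    change (Derive (fun x => T x)) with (Derive T); ring.
Qed.

Lemma frame_det N T A B t :
  frame_x N T t * frame_y A B t - frame_y N T t * frame_x A B t = N t * B t - T t * A t.
Proof.
  unfold frame_x, frame_y.
  transitivity ((N t * B t - T t * A t) * (cos t ^ 2 + sin t ^ 2)); [ring|].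
  rewrite cos2_sin2; ring.
Qed.

Lemma gamma1_frame f : gamma1 f =
  fun t => (frame_x (fun s => - (Derive f s / 2)) f t, frame_y (fun s => - (Derive f s / 2)) f t).
Proof.
  apply functional_extensionality; intros t.
  unfold gamma1, add_curve, scale_curve. rewrite circle_D1. cbn [fst snd circle].
  unfold frame_x, frame_y. f_equal. ring.
Qed.

Lemma gamma1_derivatives f : smooth f ->
  let N := fun s => - (Derive f s / 2) in
  let A := fun s => - (Derive (Derive f) s / 2) - f s in
  let B := fun s => Derive f s / 2 in
  let A' := fun s => - (Derive (Derive (Derive f)) s / 2) - 3 * Derive f s / 2 in
  let B' := fun s => - f s in
  (Derive (frame_x N f) = frame_x A B /\ Derive (frame_y N f) = frame_y A B) /\
  (Derive (frame_x A B) = frame_x A' B' /\ Derive (frame_y A B) = frame_y A' B').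
Proof.
  intros Hf N A B A' B'.
  assert (DH : forall g t, smooth g -> Derive (fun s => g s / 2) t = Derive g t / 2).
  { intros g t Hg. unfold Rdiv. now rewrite Derive_mult, Derive_const; auto using smooth_ex_derive,
      ex_derive_const; rewrite ?Rmult_0_r, ?Rplus_0_r. }
  assert (DN : forall g t, smooth g -> Derive (fun s => - (g s / 2)) t = - (Derive g t / 2)).
  { intros g t Hg. rewrite Derive_opp. now rewrite DH. }
  split; apply Derive_frame; try (unfold N, A, B; auto 8 with cont); intros t; unfold A, B, A', B', N.
  - rewrite DN by auto with cont. ring.
  - field.
  - rewrite Derive_minus, DN by (auto with cont; apply smooth_ex_derive; auto 8 with cont). field.
  - rewrite DH by auto with cont. field.
Qed.

Lemma deformation_expansion x1 y1 x2 y2 eps t :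
  smooth x1 -> smooth y1 -> smooth x2 -> smooth y2 ->
  let d := Derive in let dd := fun g => Derive (Derive g) in
  centroaffine_curvature
    (deformation (fun s => (x1 s, y1 s)) (fun s => (x2 s, y2 s)) eps) t =
  1 + eps * ((- sin t * dd y1 t - cos t * dd x1 t + (cos t * d y1 t - sin t * d x1 t))
    + eps * (- sin t * dd y2 t - cos t * dd x2 t + (cos t * d y2 t - sin t * d x2 t)
             + (d x1 t * dd y1 t - d y1 t * dd x1 t))
    + eps ^ 2 * (d x1 t * dd y2 t + d x2 t * dd y1 t - d y1 t * dd x2 t - d y2 t * dd x1 t)
    + eps ^ 3 * (d x2 t * dd y2 t - d y2 t * dd x2 t)).
Proof.
  intros S1 S2 S3 S4 d dd. rewrite centroaffine_curvatureE. unfold deformation, add_curve, scale_curve.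
  cbn [fst snd circle].
  assert (DX : forall u v w s, smooth u -> smooth v -> smooth w ->
    Derive (fun r => w r + (eps * u r + eps ^ 2 * v r)) s = Derive w s + (eps * Derive u s + eps ^ 2 * Derive v s)).
  { intros u v w s Hu Hv Hw.
    rewrite !Derive_plus, !Derive_scal; trivial; apply smooth_ex_derive; auto using smooth_scal with cont. }
  assert (DDX : forall u v w s, smooth u -> smooth v -> smooth w ->
    Derive (Derive (fun r => w r + (eps * u r + eps ^ 2 * v r))) s
     = dd w s + (eps * dd u s + eps ^ 2 * dd v s)).
  { intros u v w s Hu Hv Hw.
    rewrite (Derive_ext _ (fun s => Derive w s + (eps * Derive u s + eps ^ 2 * Derive v s)))
      by (intros; now apply DX).
    apply DX; auto with cont. }
  rewrite !DX, !DDX by auto with cont. unfold dd, d.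
  rewrite Derive_sin_fun, Derive_cos_fun, Derive_opp_sin_fun. cbv beta.
  assert (Hc := cos2_sin2 t).
  match goal with |- _ = 1 + ?R => transitivity ((cos t ^ 2 + sin t ^ 2) + R) end;
    [ring|now rewrite Hc].
Qed.

(** This is why the Hessian does not depend on [g2]. All contributions linear in [g2] integrate by
    parts to multiples of one number [Z], the integral of the determinant of [gamma_0] and
    [gamma_2']. The second-order constraint then replaces [2 Z] by minus the integral of the
    determinant of [gamma_1] and [gamma_1']. *)
Lemma hessian_second_term x1 y1 x2 y2 :
  smooth x1 -> smooth y1 -> smooth x2 -> smooth y2 ->
  periodic x2 -> periodic y2 ->
  (forall t, cos t * Derive y2 t - sin t * Derive x2 t + (x1 t * Derive y1 t - y1 t * Derive x1 t)
             + (x2 t * cos t - y2 t * - sin t) = 0) ->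
  circint (fun t => - sin t * Derive (Derive y2) t - cos t * Derive (Derive x2) t
                    + (cos t * Derive y2 t - sin t * Derive x2 t)
                    + (Derive x1 t * Derive (Derive y1) t - Derive y1 t * Derive (Derive x1) t))
  = circint (fun t => Derive x1 t * Derive (Derive y1) t - Derive y1 t * Derive (Derive x1) t
                      - (x1 t * Derive y1 t - y1 t * Derive x1 t)).
Proof.
  intros S1 S2 S3 S4 Px Py Hc.
  set (Z := circint (fun t => Derive y2 t * cos t + -1 * (Derive x2 t * sin t))).
  assert (Z1 : Z = circint (fun t => Derive y2 t * cos t) - circint (fun t => Derive x2 t * sin t)).
  { unfold Z. rewrite circint_plus, circint_scal by auto 8 with cont. ring. }
  assert (Z2 : Z = circint (fun t => y2 t * sin t) + circint (fun t => x2 t * cos t)).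
  { rewrite Z1, !circint_parts by auto using smooth_cos1, smooth_sin1, periodic_cos1, periodic_sin1.
    rewrite Derive_cos_fun, Derive_sin_fun.
    rewrite (circint_ext (fun t => y2 t * - sin t) (fun t => -1 * (y2 t * sin t))) by (intros; ring).
    rewrite circint_scal by auto with cont. ring. }
  assert (Z3 : Z = - circint (fun t => Derive (Derive y2) t * sin t)
                   - circint (fun t => Derive (Derive x2) t * cos t)).
  { rewrite Z1, (circint_parts (Derive y2)), (circint_parts (Derive x2))
      by auto using smooth_cos1, smooth_sin1, periodic_cos1, periodic_sin1, smooth_Derive, periodic_Derive.
    rewrite Derive_cos_fun, Derive_sin_fun.
    rewrite (circint_ext (fun t => Derive x2 t * - sin t) (fun t => -1 * (Derive x2 t * sin t)))
      by (intros; ring).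
    rewrite circint_scal by auto with cont. ring. }
  set (W := fun t => cos t * Derive y2 t - sin t * Derive x2 t
    + (Derive x1 t * Derive (Derive y1) t - Derive y1 t * Derive (Derive x1) t)).
  assert (CW : cont W) by (unfold W; auto 10 with cont).
  rewrite (circint_ext _ (fun t => -1 * (Derive (Derive y2) t * sin t)
    + (-1 * (Derive (Derive x2) t * cos t) + W t))) by (intros; unfold W; ring).
  rewrite (circint_ext (fun t => _ - (x1 t * Derive y1 t - y1 t * Derive x1 t))
    (fun t => y2 t * sin t + (x2 t * cos t + W t))).
  - rewrite !circint_plus, !circint_scal by auto 8 with cont. lra.
  - intros t. assert (H := Hc t). unfold W. lra.
Qed.

Lemma curve_pair (g : curve) : g = fun t => (fst (g t), snd (g t)).
Proof. apply functional_extensionality; intros t. apply surjective_pairing. Qed.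

Lemma hessian_coefficient a f g2 : admissible f -> second_order_deformation (gamma1 f) g2 ->
  is_eps2_coefficient (fun eps => calB a (deformation (gamma1 f) g2 eps)) (hessian a f).
Proof.
  intros [Hf Pf] (_ & _ & [Sx2 Sy2] & Pg2 & _ & Hc).
  rewrite (curve_pair g2). rewrite gamma1_frame in *.
  set (N := fun s => - (Derive f s / 2)) in *.
  set (x1 := frame_x N f) in *. set (y1 := frame_y N f) in *.
  set (x2 := fun t => fst (g2 t)) in *. set (y2 := fun t => snd (g2 t)) in *.
  assert (SN : smooth N) by (unfold N; auto with cont).
  assert (PN : periodic N) by (intros t; unfold N; now rewrite periodic_Derive).
  destruct (smooth_frame N f SN Hf) as [Sx1 Sy1]. destruct (periodic_frame N f PN Pf) as [Px1 Py1].
  fold x1 in Sx1, Px1. fold y1 in Sy1, Py1.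
  assert (Px2 : periodic x2) by (intros t; unfold x2; now rewrite Pg2).
  assert (Py2 : periodic y2) by (intros t; unfold y2; now rewrite Pg2).
  assert (HP : forall g : R -> R, periodic g -> forall t, Derive g (t + 2 * PI) = Derive g t)
    by (intros g Hg; exact (periodic_Derive g Hg)).
  assert (D := gamma1_derivatives f Hf). cbv zeta in D. fold N x1 y1 in D.
  destruct D as [[Dx Dy] [DDx DDy]].
  set (A := fun s => - (Derive (Derive f) s / 2) - f s) in *.
  set (B := fun s => Derive f s / 2) in *.
  rewrite <- Dx in DDx. rewrite <- Dy in DDy.
  set (P1 := fun t => - sin t * Derive (Derive y1) t - cos t * Derive (Derive x1) t
    + (cos t * Derive y1 t - sin t * Derive x1 t)).
  set (P2 := fun t => - sin t * Derive (Derive y2) t - cos t * Derive (Derive x2) t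
    + (cos t * Derive y2 t - sin t * Derive x2 t)
    + (Derive x1 t * Derive (Derive y1) t - Derive y1 t * Derive (Derive x1) t)).
  (* In frame components the terms [f^2] and [f f''] cancel, leaving [f''' f' / 4 + f'^2]; one
     integration by parts finishes. *)
  assert (E2 : circint P2 = circint (fun t => Derive f t ^ 2)
                 - / 4 * circint (fun t => Derive (Derive f) t ^ 2)).
  { unfold P2. rewrite hessian_second_term; trivial.
    2: { intros t. generalize (Hc t). rewrite circle_D1. exact (fun H => H). }
    rewrite (circint_ext _ (fun t => / 4 * (Derive (Derive (Derive f)) t * Derive f t) + Derive f t ^ 2)).
    - rewrite circint_plus, circint_scal, circint_parts
        by auto 8 using smooth_Derive, periodic_Derive with cont.
      rewrite (circint_ext (fun t => Derive (Derive f) t * Derive (Derive f) t)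
        (fun t => Derive (Derive f) t ^ 2)) by (intros; ring).
      ring.
    - intros t. rewrite DDx, DDy, Dx, Dy. unfold x1, y1. rewrite !frame_det.
      unfold N, A, B. field. }
  assert (E1 : forall t, P1 t = Derive (Derive (Derive f)) t / 2 + 2 * Derive f t).
  { intros t. unfold P1. rewrite DDx, DDy, Dx, Dy. unfold frame_x, frame_y, B.
    match goal with |- ?L = ?R => transitivity (R * (cos t ^ 2 + sin t ^ 2)) end.
    - field.
    - rewrite cos2_sin2; ring. }
  unfold hessian. rewrite <- E2.
  rewrite (circint_ext (fun t => (Derive (Derive (Derive f)) t / 2 + 2 * Derive f t) ^ 2)
    (fun t => P1 t ^ 2)) by (intros; now rewrite E1).
  apply (eps2_coefficient_Rpower a P1 P2
    (fun t => Derive x1 t * Derive (Derive y2) t + Derive x2 t * Derive (Derive y1) t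
              - Derive y1 t * Derive (Derive x2) t - Derive y2 t * Derive (Derive x1) t)
    (fun t => Derive x2 t * Derive (Derive y2) t - Derive y2 t * Derive (Derive x2) t)).
  1-4: unfold P1, P2; auto 12 with cont.
  1-4: intros t; unfold P1, P2; rewrite !HP, ?periodic_cos1, ?periodic_sin1
    by auto using periodic_Derive; reflexivity.
  intros eps. apply circint_ext. intros t. f_equal.
  rewrite deformation_expansion by trivial. reflexivity.
Qed.

(** A purely radial [g2 = M gamma_0] suffices: the second-order constraint becomes the algebraic
    equation [2 M + [gamma_1, gamma_1'] = 0]. *)
Lemma second_order_deformation_exists f : admissible f ->
  exists g2, second_order_deformation (gamma1 f) g2.
Proof.
  intros [Hf Pf]. rewrite gamma1_frame.
  set (N := fun s => - (Derive f s / 2)).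
  set (x1 := frame_x N f). set (y1 := frame_y N f).
  assert (SN : smooth N) by (unfold N; auto with cont).
  assert (PN : periodic N) by (intros t; unfold N; now rewrite periodic_Derive).
  destruct (smooth_frame N f SN Hf) as [Sx1 Sy1]. destruct (periodic_frame N f PN Pf) as [Px1 Py1].
  fold x1 in Sx1, Px1. fold y1 in Sy1, Py1.
  set (M := fun t => - ((x1 t * Derive y1 t - y1 t * Derive x1 t) / 2)).
  set (Z := fun _ : R => 0).
  assert (SM : smooth M) by (unfold M; auto 8 with cont).
  assert (SZ : smooth Z) by exact (smooth_const 0).
  assert (PM : periodic M).
  { intros t. unfold M. now rewrite Px1, Py1, !periodic_Derive by easy. }
  destruct (smooth_frame M Z SM SZ) as [Sx2 Sy2].
  destruct (periodic_frame M Z PM (fun _ => eq_refl)) as [Px2 Py2].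
  exists (fun t => (frame_x M Z t, frame_y M Z t)).
  repeat apply conj; trivial.
  - intros t. now rewrite Px1, Py1.
  - intros t. now rewrite Px2, Py2.
  - intros t. rewrite circle_D1.
    change (Dcurve 1 (fun s => (x1 s, y1 s)) t) with (Derive x1 t, Derive y1 t).
    destruct (proj1 (gamma1_derivatives f Hf)) as [Dx Dy]. fold N x1 in Dx. fold N y1 in Dy.
    rewrite Dx, Dy. unfold det, x1, y1, frame_x, frame_y, N; cbn [fst snd circle].
    transitivity (0 * (cos t ^ 2 + sin t ^ 2)); [field|ring].
  - intros t. rewrite circle_D1.
    change (Dcurve 1 (fun s => (x1 s, y1 s)) t) with (Derive x1 t, Derive y1 t).
    change (Dcurve 1 (fun s => (frame_x M Z s, frame_y M Z s)) t)
      with (Derive (frame_x M Z) t, Derive (frame_y M Z) t).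
    destruct (Derive_frame M Z (Derive M) M) as [Dx Dy]; trivial.
    + intros s. unfold Z; ring.
    + intros s. unfold Z. rewrite Derive_const; ring.
    + rewrite Dx, Dy. unfold det; cbn [fst snd circle].
      transitivity (2 * M t * (cos t ^ 2 + sin t ^ 2) + (x1 t * Derive y1 t - y1 t * Derive x1 t)).
      * unfold frame_x, frame_y, Z. ring.
      * rewrite cos2_sin2. unfold M. field.
Qed.

Lemma is_hessian_hessian a : is_hessian a (hessian a).
Proof.
  intros f Hf. split; [now apply second_order_deformation_exists|].
  intros g2 Hg2. now apply hessian_coefficient.
Qed.

(** * Diagonalization of the Hessian *)

Definition hessian_polar (a : R) (f g : R -> R) : R :=
  a * (circint (fun t => Derive f t * Derive g t)
       - / 4 * circint (fun t => Derive (Derive f) t * Derive (Derive g) t))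
  + a * (a - 1) / 2
    * circint (fun t => (Derive (Derive (Derive f)) t / 2 + 2 * Derive f t)
                        * (Derive (Derive (Derive g)) t / 2 + 2 * Derive g t)).

Lemma hessian_polar_diag a f : hessian_polar a f f = hessian a f.
Proof.
  unfold hessian_polar, hessian.
  rewrite (circint_ext (fun t => Derive f t * Derive f t) (fun t => Derive f t ^ 2)) by (intros; ring).
  rewrite (circint_ext (fun t => Derive (Derive f) t * Derive (Derive f) t)
    (fun t => Derive (Derive f) t ^ 2)) by (intros; ring).
  rewrite (circint_ext (fun t => _ * (Derive (Derive (Derive f)) t / 2 + 2 * Derive f t))
    (fun t => (Derive (Derive (Derive f)) t / 2 + 2 * Derive f t) ^ 2)) by (intros; ring).
  reflexivity.
Qed.

Lemma hessian_polar_sym a f g : hessian_polar a f g = hessian_polar a g f.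
Proof.
  unfold hessian_polar. f_equal; f_equal; [f_equal; [|f_equal]|]; apply circint_ext; intros; ring.
Qed.

Lemma Derive_lin c d f g : smooth f -> smooth g ->
  Derive (fun t => c * f t + d * g t) = fun t => c * Derive f t + d * Derive g t.
Proof.
  intros Hf Hg. apply functional_extensionality; intros t.
  rewrite Derive_plus, !Derive_scal; trivial; apply smooth_ex_derive; auto using smooth_scal.
Qed.

Lemma hessian_polar_lin a c d f g h : smooth f -> smooth g -> smooth h ->
  hessian_polar a h (fun t => c * f t + d * g t)
  = c * hessian_polar a h f + d * hessian_polar a h g.
Proof.
  intros Hf Hg Hh. unfold hessian_polar.
  rewrite !Derive_lin by auto with cont.
  rewrite (circint_ext (fun t => Derive h t * _)
    (fun t => c * (Derive h t * Derive f t) + d * (Derive h t * Derive g t))) by (intros; ring).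
  rewrite (circint_ext (fun t => Derive (Derive h) t * _)
    (fun t => c * (Derive (Derive h) t * Derive (Derive f) t)
              + d * (Derive (Derive h) t * Derive (Derive g) t))) by (intros; ring).
  rewrite (circint_ext (fun t => (Derive (Derive (Derive h)) t / 2 + 2 * Derive h t) * _)
    (fun t => c * ((Derive (Derive (Derive h)) t / 2 + 2 * Derive h t)
                    * (Derive (Derive (Derive f)) t / 2 + 2 * Derive f t))
            + d * ((Derive (Derive (Derive h)) t / 2 + 2 * Derive h t)
                    * (Derive (Derive (Derive g)) t / 2 + 2 * Derive g t)))) by (intros; field).
  rewrite !circint_plus, !circint_scal by auto 12 with cont. ring.
Qed.

Lemma hessian_polarization a f g : smooth f -> smooth g ->
  hessian a (fun t => f t + g t) - hessian a f - hessian a g = 2 * hessian_polar a f g.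
Proof.
  intros Hf Hg. rewrite <- !hessian_polar_diag.
  replace (fun t => f t + g t) with (fun t => 1 * f t + 1 * g t)
    by (apply functional_extensionality; intros; ring).
  assert (Hfg : smooth (fun t => 1 * f t + 1 * g t)) by auto using smooth_plus, smooth_scal.
  rewrite hessian_polar_lin by easy. rewrite !(hessian_polar_sym a (fun t => 1 * f t + 1 * g t)).
  rewrite !hessian_polar_lin by easy. rewrite (hessian_polar_sym a g f). ring.
Qed.

Definition hessian_eigenvalue (a : R) (n : nat) : R :=
  a * INR n ^ 2 * (INR n ^ 2 - 4) / 8 * ((a - 1) * (INR n ^ 2 - 4) - 2).

(** Stated by the differential equation so that constants, at [n = 0], cosines and sines are treated
    alike. *)
Definition harmonic (n : nat) (e : R -> R) : Prop :=
  smooth e /\ periodic e /\ forall t, Derive (Derive e) t = - INR n ^ 2 * e t.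

(** Integration by parts moves all derivatives onto [e], where they become powers of [n]. Since [f]
    is arbitrary, kernel questions reduce to single coefficients without expanding [f]. *)
Lemma hessian_polar_harmonic a f n e : admissible f -> harmonic n e ->
  hessian_polar a f e = hessian_eigenvalue a n * circint (fun t => f t * e t).
Proof.
  intros [Hf Pf] (He & Pe & HD).
  assert (HD3 : forall t, Derive (Derive (Derive e)) t = - INR n ^ 2 * Derive e t).
  { intros t. rewrite (Derive_ext _ _ _ HD). apply Derive_scal. }
  assert (I1 : circint (fun t => Derive f t * Derive e t) = INR n ^ 2 * circint (fun t => f t * e t)).
  { rewrite circint_parts by auto using smooth_Derive, periodic_Derive.
    rewrite (circint_ext _ (fun t => - INR n ^ 2 * (f t * e t))) by (intros; rewrite HD; ring).
    rewrite circint_scal by auto with cont. ring. }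
  assert (I2 : circint (fun t => Derive (Derive f) t * e t) = - INR n ^ 2 * circint (fun t => f t * e t)).
  { rewrite circint_parts, I1 by auto using smooth_Derive, periodic_Derive. ring. }
  assert (I3 : circint (fun t => Derive (Derive (Derive f)) t * Derive e t)
               = - INR n ^ 4 * circint (fun t => f t * e t)).
  { rewrite circint_parts by auto using smooth_Derive, periodic_Derive.
    rewrite (circint_ext _ (fun t => - INR n ^ 2 * (Derive (Derive f) t * e t)))
      by (intros; rewrite HD; ring).
    rewrite circint_scal, I2 by auto with cont. ring. }
  unfold hessian_polar. rewrite I1.
  rewrite (circint_ext (fun t => Derive (Derive f) t * _)
    (fun t => - INR n ^ 2 * (Derive (Derive f) t * e t))) by (intros; rewrite HD; ring).
  rewrite (circint_ext (fun t => (Derive (Derive (Derive f)) t / 2 + 2 * Derive f t) * _)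
    (fun t => (2 - INR n ^ 2 / 2) * (/ 2 * (Derive (Derive (Derive f)) t * Derive e t)
              + 2 * (Derive f t * Derive e t)))) by (intros; rewrite HD3; field).
  rewrite !circint_scal, circint_plus, !circint_scal, I1, I2, I3 by auto 10 with cont.
  unfold hessian_eigenvalue. field.
Qed.

Definition trig (k : nat) (x y : R) (t : R) : R := x * cos (INR k * t) + y * sin (INR k * t).

Lemma harmonic_trig k x y : harmonic k (trig k x y).
Proof.
  repeat split.
  - apply smooth_trig.
  - intros t. unfold trig.
    now rewrite (periodic_cos k t), (periodic_sin k t).
  - assert (D : forall x y, Derive (trig k x y) = trig k (INR k * y) (- INR k * x)).
    { intros x' y'. apply functional_extensionality; intros t. apply is_derive_unique.
      unfold trig. auto_derive; [easy|ring]. }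
    intros t. rewrite !D. unfold trig. ring.
Qed.

Lemma INR_sqr_inj m n : INR m ^ 2 = INR n ^ 2 -> m = n.
Proof.
  intros H. apply INR_eq. assert (Hm := pos_INR m). assert (Hn := pos_INR n).
  assert (HH : (INR m - INR n) * (INR m + INR n) = 0)
    by (transitivity (INR m ^ 2 - INR n ^ 2); [ring|lra]).
  apply Rmult_integral in HH. destruct HH; lra.
Qed.

Lemma INR_sqr_neq4 n : n <> 2%nat -> INR n ^ 2 - 4 <> 0.
Proof. intros H2 H. apply H2, INR_sqr_inj. simpl (INR 2). lra. Qed.

(** Taking coefficients in [e'' + k^2 e = 0] gives [(k^2 - n^2) e_n = 0], so no product of
    trigonometric functions has to be integrated. *)
Lemma harmonic_coef n k e : harmonic k e -> n <> k -> cos_coef e n = 0 /\ sin_coef e n = 0.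
Proof.
  intros (He & Pe & HD) Hnk.
  assert (Hne : INR k ^ 2 - INR n ^ 2 <> 0).
  { intros H. apply Hnk. symmetry. apply INR_sqr_inj. lra. }
  assert (H0 : (fun t => Derive (Derive e) t + INR k ^ 2 * e t) = fun _ => 0).
  { apply functional_extensionality; intros t. rewrite HD. ring. }
  assert (Hc := cos_coef_oscillator e (INR k ^ 2) n He Pe).
  assert (Hs := sin_coef_oscillator e (INR k ^ 2) n He Pe).
  rewrite H0 in Hc, Hs.
  rewrite cos_coefE, (circint_ext _ (fun _ => 0)), circint_const in Hc by (intros; ring).
  rewrite sin_coefE, (circint_ext _ (fun _ => 0)), circint_const in Hs by (intros; ring).
  unfold Rdiv in Hc, Hs. rewrite Rmult_0_r, Rmult_0_l in Hc, Hs.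
  symmetry in Hc, Hs. apply Rmult_integral in Hc, Hs. tauto.
Qed.

Lemma trig_coef_self k x y : (1 <= k)%nat ->
  cos_coef (trig k x y) k = x /\ sin_coef (trig k x y) k = y.
Proof.
  intros Hk. assert (Hpi := PI_RGT_0).
  assert (H2k : forall t, INR (2 * k) * t = 2 * (INR k * t)) by (intros; rewrite mult_INR; simpl; ring).
  rewrite cos_coefE, sin_coefE. unfold trig. split.
  - rewrite (circint_ext _ (fun t => x / 2 + (x / 2 * cos (INR (2 * k) * t) + y / 2 * sin (INR (2 * k) * t)))).
    + rewrite !circint_plus, !circint_scal, circint_const, circint_cos, circint_sin
        by (auto with cont; lia). field. lra.
    + intros t. rewrite H2k, cos_2a_cos, sin_2a. field.
  - rewrite (circint_ext _ (fun t => y / 2 + (- (y / 2) * cos (INR (2 * k) * t) + x / 2 * sin (INR (2 * k) * t)))).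
    + rewrite !circint_plus, !circint_scal, circint_const, circint_cos, circint_sin
        by (auto with cont; lia). field. lra.
    + intros t. rewrite H2k, cos_2a_sin, sin_2a. field.
Qed.

Lemma cos_coef_const0 c : cos_coef (fun _ => c) 0 = 2 * c.
Proof.
  assert (Hpi := PI_RGT_0). rewrite cos_coef_0, circint_const. field. lra.
Qed.

Lemma sin_coef_0 f : sin_coef f 0 = 0.
Proof.
  rewrite sin_coefE, (circint_ext _ (fun _ => 0)), circint_const.
  - unfold Rdiv; ring.
  - intros t. simpl. rewrite Rmult_0_l, sin_0; ring.
Qed.

Lemma harmonic_const c : harmonic 0 (fun _ => c).
Proof.
  repeat split; [apply smooth_const|]. intros t.
  rewrite (Derive_ext _ (fun _ => 0)) by (intros; apply Derive_const).
  rewrite Derive_const. simpl; ring.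
Qed.

Lemma coef_plus f g n : cont f -> cont g ->
  cos_coef (fun t => f t + g t) n = cos_coef f n + cos_coef g n /\
  sin_coef (fun t => f t + g t) n = sin_coef f n + sin_coef g n.
Proof.
  intros Cf Cg. assert (Hpi := PI_RGT_0). rewrite !cos_coefE, !sin_coefE. split.
  - rewrite (circint_ext _ (fun t => f t * cos (INR n * t) + g t * cos (INR n * t))) by (intros; ring).
    rewrite circint_plus by auto with cont. field. lra.
  - rewrite (circint_ext _ (fun t => f t * sin (INR n * t) + g t * sin (INR n * t))) by (intros; ring).
    rewrite circint_plus by auto with cont. field. lra.
Qed.

Lemma trivial_deformationE f : trivial_deformation f <->
  exists c0 c1 c2, forall t, f t = c0 + trig 2 c1 c2 t.
Proof.
  unfold trivial_deformation, trig. replace (INR 2) with 2 by (simpl; lra).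
  split; intros (c0 & c1 & c2 & H); exists c0, c1, c2; intros t; rewrite H; ring.
Qed.

Lemma trivial_coef f n : trivial_deformation f -> n <> 0%nat -> n <> 2%nat ->
  cos_coef f n = 0 /\ sin_coef f n = 0.
Proof.
  intros Hf H0 H2. apply trivial_deformationE in Hf. destruct Hf as (c0 & c1 & c2 & Hf).
  apply functional_extensionality in Hf. rewrite Hf.
  destruct (harmonic_trig 2 c1 c2) as (St & _ & _).
  destruct (coef_plus (fun _ => c0) (trig 2 c1 c2) n) as [-> ->]; auto with cont.
  destruct (harmonic_coef n 0 _ (harmonic_const c0) H0) as [-> ->].
  destruct (harmonic_coef n 2 _ (harmonic_trig 2 c1 c2) H2) as [-> ->]. split; ring.
Qed.

(** After the frequencies 0, 2 and [k] are subtracted, every coefficient vanishes and uniqueness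
    applies. *)
Lemma fourier_support f k : admissible f -> k <> 0%nat -> k <> 2%nat ->
  (forall n, n <> 0%nat -> n <> 2%nat -> n <> k -> cos_coef f n = 0 /\ sin_coef f n = 0) ->
  trivial_deformation (fun t => f t - trig k (cos_coef f k) (sin_coef f k) t).
Proof.
  intros [Hf Pf] Hk0 Hk2 Hz. apply trivial_deformationE.
  set (x := cos_coef f k) in *. set (y := sin_coef f k) in *.
  (* Halved because the coefficient of index 0 of a constant [c] is [2 c]. *)
  set (c0 := cos_coef f 0 / 2). set (c1 := cos_coef f 2). set (c2 := sin_coef f 2).
  exists c0, c1, c2.
  set (h := fun t => f t + (trig k (- x) (- y) t + (- c0 + trig 2 (- c1) (- c2) t))).
  assert (T1 := harmonic_trig k (- x) (- y)). assert (T2 := harmonic_trig 2 (- c1) (- c2)).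
  assert (T0 := harmonic_const (- c0)).
  assert (S1 := proj1 T1). assert (P1 := proj1 (proj2 T1)).
  assert (S2 := proj1 T2). assert (P2 := proj1 (proj2 T2)).
  assert (Hh : forall n, cos_coef h n = cos_coef f n + (cos_coef (trig k (- x) (- y)) n
      + (cos_coef (fun _ => - c0) n + cos_coef (trig 2 (- c1) (- c2)) n)) /\
    sin_coef h n = sin_coef f n + (sin_coef (trig k (- x) (- y)) n
      + (sin_coef (fun _ => - c0) n + sin_coef (trig 2 (- c1) (- c2)) n))).
  { intros n. unfold h.
    destruct (coef_plus (fun _ => - c0) (trig 2 (- c1) (- c2)) n) as [A1 A2]; auto with cont.
    destruct (coef_plus (trig k (- x) (- y)) (fun t => - c0 + trig 2 (- c1) (- c2) t) n) as [A3 A4];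
      auto with cont.
    destruct (coef_plus f (fun t => trig k (- x) (- y) t + (- c0 + trig 2 (- c1) (- c2) t)) n)
      as [A5 A6]; auto with cont.
    now rewrite A5, A6, A3, A4, A1, A2. }
  assert (Hzero : forall n, cos_coef h n = 0 /\ sin_coef h n = 0).
  { intros n. destruct (Hh n) as [-> ->].
    destruct (Nat.eq_dec n 0) as [->|N0]; [|destruct (Nat.eq_dec n 2) as [->|N2];
      [|destruct (Nat.eq_dec n k) as [->|Nk]]].
    - rewrite !sin_coef_0.
      rewrite cos_coef_const0.
      destruct (harmonic_coef 0 k _ T1 ltac:(lia)) as [-> _].
      destruct (harmonic_coef 0 2 _ T2 ltac:(lia)) as [-> _]. unfold c0. split; field.
    - destruct (trig_coef_self 2 (- c1) (- c2) ltac:(lia)) as [-> ->].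
      destruct (harmonic_coef 2 k _ T1 ltac:(lia)) as [-> ->].
      destruct (harmonic_coef 2 0 _ T0 ltac:(lia)) as [-> ->].
      fold c1 c2. split; ring.
    - destruct (trig_coef_self k (- x) (- y) ltac:(lia)) as [-> ->].
      destruct (harmonic_coef k 2 _ T2 ltac:(lia)) as [-> ->].
      destruct (harmonic_coef k 0 _ T0 ltac:(lia)) as [-> ->].
      fold x y. split; ring.
    - destruct (harmonic_coef n k _ T1 ltac:(lia)) as [-> ->].
      destruct (harmonic_coef n 2 _ T2 ltac:(lia)) as [-> ->].
      destruct (harmonic_coef n 0 _ T0 ltac:(lia)) as [-> ->].
      destruct (Hz n N0 N2 Nk) as [-> ->]. split; ring. }
  assert (H : forall t, h t = 0).
  { apply fourier_unique.
    - unfold h. auto 8 with cont.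
    - intros t. unfold h. now rewrite Pf, P1, P2.
    - intros n; exact (proj1 (Hzero n)).
    - intros n; exact (proj2 (Hzero n)). }
  intros t. assert (Ht := H t). unfold h, trig in Ht. unfold trig. lra.
Qed.

(** * Kernel and sign of the Hessian *)

Lemma hessian_eigenvalue_neq0 a n : a <> 0 -> n <> 0%nat -> n <> 2%nat ->
  a <> (INR n ^ 2 - 2) / (INR n ^ 2 - 4) -> hessian_eigenvalue a n <> 0.
Proof.
  intros Ha H0 H2 Hne.
  assert (Hn0 : INR n <> 0) by (now apply not_0_INR).
  assert (Hn2 := INR_sqr_neq4 n H2).
  assert (Hlast : (a - 1) * (INR n ^ 2 - 4) - 2 <> 0).
  { intros H. apply Hne. apply (Rmult_eq_reg_r (INR n ^ 2 - 4)); [|easy].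
    replace ((INR n ^ 2 - 2) / (INR n ^ 2 - 4) * (INR n ^ 2 - 4)) with (INR n ^ 2 - 2) by (now field).
    lra. }
  unfold hessian_eigenvalue.
  repeat apply Rmult_integral_contrapositive_currified; trivial; try lra.
Qed.

Lemma hessian_eigenvalue_eq0 k : k <> 2%nat ->
  hessian_eigenvalue ((INR k ^ 2 - 2) / (INR k ^ 2 - 4)) k = 0.
Proof.
  intros H2. unfold hessian_eigenvalue. field. now apply INR_sqr_neq4.
Qed.

(** The exponent is [1 + 2 / (k^2 - 4)], injective in [k^2]. For a given [a] at most one nontrivial
    frequency can therefore lie in the kernel. *)
Lemma degenerate_exponent_inj k n : k <> 2%nat -> n <> 2%nat ->
  (INR k ^ 2 - 2) / (INR k ^ 2 - 4) = (INR n ^ 2 - 2) / (INR n ^ 2 - 4) -> n = k.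
Proof.
  intros Hk Hn H. apply INR_sqr_neq4 in Hk, Hn.
  assert (HE : INR k ^ 2 = INR n ^ 2).
  { apply (f_equal (fun z => z * (INR k ^ 2 - 4) * (INR n ^ 2 - 4))) in H.
    replace ((INR k ^ 2 - 2) / (INR k ^ 2 - 4) * (INR k ^ 2 - 4) * (INR n ^ 2 - 4))
      with ((INR k ^ 2 - 2) * (INR n ^ 2 - 4)) in H by (now field).
    replace ((INR n ^ 2 - 2) / (INR n ^ 2 - 4) * (INR k ^ 2 - 4) * (INR n ^ 2 - 4))
      with ((INR n ^ 2 - 2) * (INR k ^ 2 - 4)) in H by (now field).
    lra. }
  symmetry. now apply INR_sqr_inj.
Qed.

(** Testing the kernel condition against functions of frequency [n] alone isolates one
    eigenvalue. *)
Lemma kernel_coef a f n : in_kernel (hessian a) f -> hessian_eigenvalue a n <> 0 ->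
  cos_coef f n = 0 /\ sin_coef f n = 0.
Proof.
  intros [Hf Hker] Hn.
  assert (H : forall e, harmonic n e -> circint (fun t => f t * e t) = 0).
  { intros e He. assert (Hp := hessian_polar_harmonic a f n e Hf He).
    assert (HK := Hker e (conj (proj1 He) (proj1 (proj2 He)))).
    rewrite hessian_polarization in HK; [|apply Hf|apply He].
    rewrite Hp in HK. apply (Rmult_eq_reg_l (hessian_eigenvalue a n)); [lra|easy]. }
  rewrite cos_coefE, sin_coefE. split.
  - rewrite (circint_ext _ (fun t => f t * trig n 1 0 t)) by (intros; unfold trig; ring).
    rewrite H by apply harmonic_trig. unfold Rdiv; ring.
  - rewrite (circint_ext _ (fun t => f t * trig n 0 1 t)) by (intros; unfold trig; ring).
    rewrite H by apply harmonic_trig. unfold Rdiv; ring.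
Qed.

(** By linearity: frequencies 0 and 2 have eigenvalue 0 for every [a], and frequency [k] has it by
    hypothesis. *)
Lemma kernel_of_trig a f k x y : admissible f -> hessian_eigenvalue a k = 0 ->
  trivial_deformation (fun t => f t - trig k x y t) -> in_kernel (hessian a) f.
Proof.
  intros Hf Hk Ht. split; [easy|]. intros g Hg.
  rewrite hessian_polarization, hessian_polar_sym by (apply Hf || apply Hg).
  apply trivial_deformationE in Ht. destruct Ht as (c0 & c1 & c2 & Ht).
  assert (Hz : forall n e, hessian_eigenvalue a n = 0 -> harmonic n e -> hessian_polar a g e = 0).
  { intros n e Hn He. rewrite (hessian_polar_harmonic a g n e Hg He), Hn. ring. }
  assert (T1 := harmonic_trig k x y). assert (T2 := harmonic_trig 2 c1 c2).
  assert (T0 := harmonic_const c0).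
  replace f with (fun t => 1 * trig k x y t + 1 * (1 * c0 + 1 * trig 2 c1 c2 t)).
  - rewrite (hessian_polar_lin a 1 1 (trig k x y) (fun t => 1 * c0 + 1 * trig 2 c1 c2 t)),
      (hessian_polar_lin a 1 1 (fun _ => c0) (trig 2 c1 c2)).
    + rewrite (Hz k _ Hk T1), (Hz 0%nat _ ltac:(unfold hessian_eigenvalue; simpl; field) T0),
        (Hz 2%nat _ ltac:(unfold hessian_eigenvalue; simpl; field) T2). ring.
    + apply T0.
    + apply T2.
    + apply Hg.
    + apply T1.
    + apply smooth_plus; apply smooth_scal; [apply T0|apply T2].
    + apply Hg.
  - apply functional_extensionality; intros t. generalize (Ht t). lra.
Qed.

Lemma trig_nontrivial k x y : k <> 0%nat -> k <> 2%nat -> x <> 0 ->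
  ~ trivial_deformation (trig k x y).
Proof.
  intros H0 H2 Hx Ht. apply Hx.
  rewrite <- (proj1 (trig_coef_self k x y ltac:(lia))).
  exact (proj1 (trivial_coef _ k Ht H0 H2)).
Qed.

Lemma hessian_trig a k x : (1 <= k)%nat ->
  hessian a (trig k x 0) = hessian_eigenvalue a k * (PI * x ^ 2).
Proof.
  intros Hk. assert (T := harmonic_trig k x 0).
  rewrite <- hessian_polar_diag, (hessian_polar_harmonic a _ k); [|split; apply T|easy].
  f_equal. rewrite (circint_ext _ (fun t => x * (trig k x 0 t * cos (INR k * t))))
    by (intros; unfold trig; ring).
  assert (Hc := proj1 (trig_coef_self k x 0 Hk)). rewrite cos_coefE in Hc.
  assert (Hpi := PI_RGT_0).
  destruct T as (S & _ & _). rewrite circint_scal by auto with cont.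
  replace (circint (fun t => trig k x 0 t * cos (INR k * t))) with
    (PI * (circint (fun t => trig k x 0 t * cos (INR k * t)) / PI)) by (field; lra).
  rewrite Hc. ring.
Qed.

(** The eigenvalues at frequencies 1 and 3 are [3 a (3 a - 1) / 8] and [45 a (5 a - 7) / 8]. On this
    interval the first is nonnegative and the second nonpositive, which excludes strict definiteness
    of either sign, endpoints included. *)
Lemma hessian_not_sign_definite a : 1 / 3 <= a <= 7 / 5 -> ~ sign_definite (hessian a).
Proof.
  intros Ha. assert (Hpi := PI_RGT_0).
  assert (N1 : ~ trivial_deformation (trig 1 1 0)) by (apply trig_nontrivial; lia || lra).
  assert (N3 : ~ trivial_deformation (trig 3 1 0)) by (apply trig_nontrivial; lia || lra).
  assert (A1 : admissible (trig 1 1 0)) by (split; apply harmonic_trig).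
  assert (A3 : admissible (trig 3 1 0)) by (split; apply harmonic_trig).
  intros [H|H].
  - assert (H3 := H _ A3 N3). rewrite hessian_trig in H3 by lia.
    unfold hessian_eigenvalue in H3. replace (INR 3) with 3 in H3 by (simpl; lra).
    assert (a * (7 - 5 * a) >= 0) by nra. nra.
  - assert (H1 := H _ A1 N1). rewrite hessian_trig in H1 by lia.
    unfold hessian_eigenvalue in H1. replace (INR 1) with 1 in H1 by (simpl; lra).
    assert (a * (3 * a - 1) >= 0) by nra. nra.
Qed.

Lemma hessian_degenerate_iff a : a <> 0 ->
  (degenerate (hessian a) <->
   exists k : nat, (0 < k)%nat /\ k <> 2%nat /\ a = (INR k ^ 2 - 2) / (INR k ^ 2 - 4)).
Proof.
  intros Ha. split.
  - intros (f & Hker & Hnt). apply NNPP. intros Hno. apply Hnt.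
    assert (Hz : forall n, n <> 0%nat -> n <> 2%nat -> cos_coef f n = 0 /\ sin_coef f n = 0).
    { intros n H0 H2. apply (kernel_coef a); trivial. apply hessian_eigenvalue_neq0; trivial.
      intros E. apply Hno. exists n. repeat split; trivial. lia. }
    (* Frequency 1 is an arbitrary choice: its coefficients vanish too, so the subtracted term is
       0. *)
    assert (Ht := fourier_support f 1 (proj1 Hker) ltac:(lia) ltac:(lia) (fun n H0 H2 _ => Hz n H0 H2)).
    destruct (Hz 1%nat) as [E1 E2]; [lia..|]. rewrite E1, E2 in Ht.
    destruct Ht as (c0 & c1 & c2 & Ht). exists c0, c1, c2. intros t. rewrite <- Ht. unfold trig. ring.
  - intros (k & Hk & Hk2 & E). exists (trig k 1 0). split.
    + apply (kernel_of_trig a _ k 1 0).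
      * split; apply harmonic_trig.
      * rewrite E. now apply hessian_eigenvalue_eq0.
      * exists 0, 0, 0. intros t. ring.
    + apply trig_nontrivial; lia || lra.
Qed.

Lemma hessian_kernel_line a k : a <> 0 -> (0 < k)%nat -> k <> 2%nat ->
  a = (INR k ^ 2 - 2) / (INR k ^ 2 - 4) -> one_dimensional_kernel (hessian a).
Proof.
  intros Ha Hk Hk2 E. assert (T0 := harmonic_trig k 1 0). assert (T1 := harmonic_trig k 0 (-1)).
  assert (HE : forall x y, (fun t => x * trig k 1 0 t + y * trig k 0 (-1) t) = trig k x (- y)).
  { intros x y. apply functional_extensionality; intros t. unfold trig. ring. }
  (* With [c_k] the cosine coefficient minus [i] times the sine coefficient, [cos (k t)] has
     [c_k = 1]. Its multiple by [i] thus has sine coefficient -1, which also accounts for the sign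
     of [y] below. *)
  exists (trig k 1 0), (trig k 0 (-1)). split; [split; apply T0|]. split.
  { apply trig_nontrivial; lia || lra. }
  split; [split; apply T1|]. split.
  { intros n Hn. destruct (Nat.eq_dec n k) as [->|Hnk].
    - destruct (trig_coef_self k 1 0 Hn) as [-> ->]. destruct (trig_coef_self k 0 (-1) Hn) as [-> ->].
      split; ring.
    - destruct (harmonic_coef n k _ T0 Hnk) as [-> ->]. destruct (harmonic_coef n k _ T1 Hnk) as [-> ->].
      split; ring. }
  intros f Hf. split.
  - intros Hker. exists (cos_coef f k), (- sin_coef f k).
    assert (Ht := fourier_support f k Hf ltac:(lia) Hk2).
    destruct Ht as (c0 & c1 & c2 & Ht).
    + intros n H0 H2 Hnk. apply (kernel_coef a); trivial. apply hessian_eigenvalue_neq0; trivial.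
      intros E'. apply Hnk. apply degenerate_exponent_inj; trivial. now rewrite <- E.
    + exists c0, c1, c2. intros t. rewrite <- Ht. unfold trig. ring.
  - intros (x & y & Ht). apply (kernel_of_trig a f k x (- y)); trivial.
    + rewrite E. now apply hessian_eigenvalue_eq0.
    + destruct Ht as (c0 & c1 & c2 & Ht). exists c0, c1, c2. intros t. rewrite <- Ht. unfold trig. ring.
Qed.

Theorem theorem2 (a : R) (ha : a <> 0) :
  (a < 0 -> local_min (calB a) circle) /\
  (0 < a < 1 / 3 -> local_max (calB a) circle) /\
  (7 / 5 < a -> local_min (calB a) circle) /\
  exists Q : (R -> R) -> R,
    is_hessian a Q /\
    (~ (a < 0 \/ 0 < a < 1 / 3 \/ 7 / 5 < a) -> ~ sign_definite Q) /\
    (degenerate Q <->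
     exists k : nat, (0 < k)%nat /\ k <> 2%nat /\
       a = (INR k ^ 2 - 2) / (INR k ^ 2 - 4)) /\
    (degenerate Q -> one_dimensional_kernel Q).
Proof.
  split; [exact (circle_local_min_neg a)|].
  split; [exact (circle_local_max a)|].
  split; [exact (circle_local_min_gt a)|].
  exists (hessian a). split; [apply is_hessian_hessian|]. split.
  - intros Hcase. apply hessian_not_sign_definite.
    destruct (Rlt_le_dec a 0); [tauto|]. destruct (Rlt_le_dec a (1 / 3)).
    + exfalso. apply Hcase. right; left. lra.
    + split; [easy|]. apply Rnot_lt_le. tauto.
  - split; [now apply hessian_degenerate_iff|].
    intros Hd. apply hessian_degenerate_iff in Hd; [|easy].
    destruct Hd as (k & Hk & Hk2 & E). now apply (hessian_kernel_line a k).
Qed.
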